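(* Let $f:L^2(0,T)\to\mathbb{R}$ be convex, and let $f$ and $J=f+\mathrm{TGV}$ on $\mathrm{BV}(0,T)$ satisfy: (A1) $f$ is continuously Fréchet differentiable; (A2) there is $L_f>0$ with $\|\nabla f(u_1)-\nabla f(u_2)\|_{L^2}\le L_f\|u_1-u_2\|_{L^2}$ for all $u_1,u_2\in L^2(0,T)$; (A3) there is $C_f>0$ with $f(u)\ge-C_f$ for all $u\in L^2(0,T)$; (A4) the sublevel sets of $J$ are bounded in $\mathrm{BV}(0,T)$. Let $\{u_k\}_{k\ge1}$ be generated by the algorithm described in the context, assumed not to terminate after finitely many iterations. Then, for all $k\ge1$, $$J(u_k)-\min_{u\in\mathrm{BV}(0,T)}J(u)\le\widehat r_J(u_k)\le\Psi(u_k).$$ Moreover, let $C>0$ be such that $\max\{\|u_k\|_{L^2},M_0\|\widehat u_k\|_{L^2}\}\le C$ for all $k\ge1$, where $M_0=f(0)+C_f$. Then, for all $k\ge1$, $$J(u_k)-\min_{u\in\mathrm{BV}(0,T)}J(u)\le\widehat r_J(u_k)\le\frac{\widehat r_J(u_1)}{1+q(k-1)}\quad\text{where}\quad q=\frac{\widehat r_J(u_1)}{8L_fC^2}.$$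
   Context: $T>0$, $\alpha,\beta>0$ fixed. $C_0(0,T)$: continuous functions on $(0,T)$ vanishing at the boundary, uniform norm $\|\cdot\|_C$; $M(0,T)=C_0(0,T)^*$ with dual norm $\|\cdot\|_M$; $\mathrm{BV}(0,T)$: functions $u\in L^1(0,T)$ with $Du\in M(0,T)$, norm $\|u\|_{L^1}+\|Du\|_M$. $\mathrm{TGV}(u)=\sup\{\int_0^Tuv''\,|\,v\in C_c^\infty(0,T),\|v\|_C\le\alpha,\|v'\|_C\le\beta\}=\inf_{w\in\mathrm{BV}(0,T)}\alpha\|Du-w\|_M+\beta\|Dw\|_M$. $\mathcal{L}$: affine functions $x\mapsto cx+d$. $S_{x}=1_{(x,T)}$; $K_{x}(y)=1_{(0,x)}(y)(x-y)$ if $x<T/2$, $K_{x}(y)=1_{(x,T)}(y)(y-x)$ if $x\ge T/2$. $\operatorname{Ext}B:=\{\pm S_x/\alpha\,|\,x\in(0,T)\}\cup\{\pm K_x/\beta\,|\,x\in(\beta/\alpha,T-\beta/\alpha)\}$. $\nabla f(u)\in L^2(0,T)$: Riesz representative of the Fréchet derivative. For a finite ordered set $\mathcal{A}=\{v_j\}_{j=1}^N\subset\operatorname{Ext}B$, let $\mathcal{P}(\mathcal{A})$ be the problem $\min_{\lambda\in\mathbb{R}_+^N,\,\ell\in\mathcal{L}}\big[f(\sum_{j=1}^N\lambda_jv_j+\ell)+\sum_{j=1}^N\lambda_j\big]$. Algorithm. Input: a finite set $\mathcal{A}_0=\{u_j^0\}_{j=1}^{N_0}\subset\operatorname{Ext}B$.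 Compute a minimizer of $\mathcal{P}(\mathcal{A}_0)$, let $u_1$ be the corresponding function $\sum_j\lambda_ju_j^0+\ell$, and obtain $\mathcal{A}_1$ from $\mathcal{A}_0$ by removing all elements with zero weight. For $k=1,2,\dots$: write $\mathcal{A}_k=\{u_j^k\}_{j=1}^{N_k}$ and $u_k=\sum_{j=1}^{N_k}\lambda_j^ku_j^k+\ell^k$, where $(\lambda^k,\ell^k)$ consists of the remaining (positive) weights and the affine part of the previously computed minimizer (it is a minimizer of $\mathcal{P}(\mathcal{A}_k)$). Set $p_k(x)=\int_0^x\nabla f(u_k)(s)\,ds$, $P_k(x)=-\int_0^xp_k(s)\,ds$ and choose $\hat x_k^S,\hat x_k^K\in(0,T)$ with $|p_k(\hat x_k^S)|=\|p_k\|_C$, $|P_k(\hat x_k^K)|=\|P_k\|_C$. If $\|p_k\|_C\le\alpha$ and $\|P_k\|_C\le\beta$, terminate. Otherwise set $\widehat u_k=(\operatorname{sign}(p_k(\hat x_k^S))/\alpha)S_{\hat x_k^S}$ if $\|p_k\|_C/\alpha\ge\|P_k\|_C/\beta$ and $\widehat u_k=(\operatorname{sign}(P_k(\hat x_k^K))/\beta)K_{\hat x_k^K}$ else; let $\mathcal{A}_k^+=\mathcal{A}_k\cup\{\widehat u_k\}$, compute a minimizer of $\mathcal{P}(\mathcal{A}_k^+)$, let $u_{k+1}$ be the corresponding function, and obtain $\mathcal{A}_{k+1}$ from $\mathcal{A}_k^+$ by removing all elements with zero weight. Constraint violation: $\Psi(u_k)=M_0\big(\max\{\|p_k\|_C/\alpha,\|P_k\|_C/\beta\}-1\big)$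 with $M_0=f(0)+C_f$. Residual: $\widehat r_J(u_k)=f(u_k)+\sum_{j=1}^{N_k}\lambda_j^k-\min_{u\in\mathrm{BV}(0,T)}J(u)$ (the minimum exists under (A1)–(A4)).
   Formalization: TGV is taken as the infimum over w in BV(0,T) of α‖Du−w‖_M+β‖Dw‖_M; the supremum formula printed as equal to it has α and β interchanged (it should read ‖v‖_C≤β, ‖v'‖_C≤α) and is not used. *)

(* Defs.v *)
From HB Require Import structures.
From mathcomp Require Import all_boot all_order all_algebra finmap.
From mathcomp Require Import all_classical all_reals all_analysis.
Set Implicit Arguments.
Unset Strict Implicit.
Unset Printing Implicit Defensive.
Import Order.TTheory GRing.Theory Num.Theory.
Import numFieldNormedType.Exports.
Local Open Scope classical_set_scope.
Local Open Scope fset_scope.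
Local Open Scope ring_scope.

(** Functions on (0,T) are represented by functions [R -> R] whose values
    outside the interval are irrelevant: norms and integrals only look at
    the interval. An element of L^p(0,T) is represented by a measurable
    function; functionals on L^2(0,T) are functionals on square-integrable
    functions that respect equality almost everywhere ([ae_invariant]), and
    nothing is assumed about them elsewhere. *)

Section Spaces.
Context {R : realType}.
Implicit Types (T a x y : R) (u v w g h phi psi : R -> R).

Definition muT T : {measure set (measurableTypeR R) -> \bar R} :=
  mrestr (@lebesgue_measure R) (measurable_itv `]0, T[).

Definition L1 T : set (R -> R) := [set u | u \in Lfun (muT T) 1%E].

Definition L2 T : set (R -> R) := [set u | u \in Lfun (muT T) 2%:E].

Definition normL1 T u : R := fine ('N[muT T]_1%E[EFin \o u])%E.

Definition normL2 T u : R := fine ('N[muT T]_2%:E[EFin \o u])%E.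

Definition dotL2 T u v : R := (\int[muT T]_x (u x * v x))%R.

Definition normC T phi : R := sup [set `|phi x| | x in `]0, T[].

Definition C0 T : set (R -> R) :=
  [set phi | [/\ {in `]0, T[, continuous phi},
                 phi x @[x --> 0^'+] --> 0 & phi x @[x --> T^'-] --> 0]].

Definition Ccinfty T : set (R -> R) :=
  [set phi | (forall n x, derivable (derive1n n phi) x 1) /\
     exists a b, [/\ 0 < a, b < T & forall x, phi x != 0 -> a <= x <= b]].

(** M(0,T) is the dual of C_0(0,T): only the values on [C0 T] matter. *)
Definition Mspace T : set ((R -> R) -> R) :=
  [set m | (forall a phi psi, C0 T phi -> C0 T psi ->
              m (a *: phi + psi) = a * m phi + m psi) /\
           exists B, forall phi, C0 T phi -> `|m phi| <= B * normC T phi].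

Definition normM T (m : (R -> R) -> R) : R :=
  sup [set `|m phi| | phi in C0 T `&` [set phi | normC T phi <= 1]].

(** The element of M(0,T) given by the density [w]. *)
Definition density T w : (R -> R) -> R := fun phi => dotL2 T w phi.

Definition distributional_derivative T u (m : (R -> R) -> R) : Prop :=
  Mspace T m /\ forall phi, Ccinfty T phi -> m phi = - dotL2 T u (derive1 phi).

(** Unique on [C0 T] for u in BV(0,T), by density of [Ccinfty T] in [C0 T]. *)
Definition BVderiv T u : (R -> R) -> R :=
  xget (fun=> 0) [set m | distributional_derivative T u m].

Definition BV T : set (R -> R) :=
  [set u | L1 T u /\ exists m, distributional_derivative T u m].

Definition normBV T u : R := normL1 T u + normM T (BVderiv T u).

(** Only used for u in BV(0,T), where the infimum is that of a nonempty set
    of nonnegative reals. The dual formula is the supremum of the integrals of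
    u * v'' over v in C_c^oo with |v| <= beta and |v'| <= alpha. *)
Definition TGV T (alpha beta : R) u : R :=
  inf [set alpha * normM T (BVderiv T u - density T w) + beta * normM T (BVderiv T w)
      | w in BV T].

Section Functional.
Variables (T : R) (f : (R -> R) -> R).

Definition ae_invariant : Prop :=
  forall u v, L2 T u -> L2 T v -> {ae muT T, forall x, u x = v x} -> f u = f v.

Definition convexL2 : Prop :=
  forall u v (t : R), L2 T u -> L2 T v -> 0 <= t <= 1 ->
    f (t *: u + (1 - t) *: v) <= t * f u + (1 - t) * f v.

Definition bounded_linear (A : (R -> R) -> R) : Prop :=
  (forall a h h', L2 T h -> L2 T h' -> A (a *: h + h') = a * A h + A h') /\
  exists B, forall h, L2 T h -> `|A h| <= B * normL2 T h.

Definition frechet_derivative u (A : (R -> R) -> R) : Prop :=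
  bounded_linear A /\
  forall eps : R, 0 < eps -> exists2 delta : R, 0 < delta &
    forall h, L2 T h -> normL2 T h <= delta ->
      `|f (u + h) - f u - A h| <= eps * normL2 T h.

Definition continuously_frechet_differentiable : Prop :=
  exists Df : (R -> R) -> (R -> R) -> R,
    (forall u, L2 T u -> frechet_derivative u (Df u)) /\
    (forall u, L2 T u -> forall eps : R, 0 < eps ->
       exists2 delta : R, 0 < delta &
         forall v, L2 T v -> normL2 T (v - u) <= delta ->
         forall h, L2 T h -> `|Df v h - Df u h| <= eps * normL2 T h).

Definition is_gradient u g : Prop :=
  L2 T g /\
  exists2 A, frechet_derivative u A & forall h, L2 T h -> A h = dotL2 T g h.

Variables (alpha beta : R).

Definition J u : R := f u + TGV T alpha beta u.

Definition bounded_sublevels : Prop :=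
  forall c, exists B, forall u, BV T u -> J u <= c -> normBV T u <= B.

(** An infimum; it is attained under the standing assumptions of the theorem,
    and is then the minimum of J over BV(0,T). *)
Definition minJ : R := inf [set J u | u in BV T].

End Functional.

Definition affine_fun : set (R -> R) :=
  [set l | exists c d, l = fun x => c * x + d].

Definition Sfun T x : R -> R := \1_(`]x, T[).

Definition Kfun T x : R -> R := fun y =>
  if x < T / 2 then \1_(`]0, x[) y * (x - y) else \1_(`]x, T[) y * (y - x).

Definition ExtB T (alpha beta : R) : set (R -> R) :=
  [set v | exists2 x : R, 0 < x < T &
             v = alpha^-1 *: Sfun T x \/ v = - (alpha^-1 *: Sfun T x)] `|`
  [set v | exists2 x : R, beta / alpha < x < T - beta / alpha &
             v = beta^-1 *: Kfun T x \/ v = - (beta^-1 *: Kfun T x)].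

(** The weights of a finite set of atoms are indexed by the atoms themselves. *)
Definition combination (A : {fset (R -> R)}) (lam : (R -> R) -> R)
    (l : R -> R) : R -> R :=
  \sum_(v <- A) lam v *: v + l.

Definition objective (f : (R -> R) -> R) A lam (l : R -> R) : R :=
  f (combination A lam l) + \sum_(v <- A) lam v.

Definition feasible (A : {fset (R -> R)}) (lam : (R -> R) -> R)
    (l : R -> R) : Prop :=
  (forall v, v \in A -> 0 <= lam v) /\ affine_fun l.

(** (lam, l) solves the problem P(A). *)
Definition minimizerP (f : (R -> R) -> R) A lam (l : R -> R) : Prop :=
  feasible A lam l /\
  forall lam' l', feasible A lam' l' ->
    objective f A lam l <= objective f A lam' l'.

Definition prune (A : {fset (R -> R)}) (lam : (R -> R) -> R) : {fset (R -> R)} :=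
  [fset v in A | lam v != 0].

Definition primitive g : R -> R :=
  fun x => (\int[@lebesgue_measure R]_(s in `[0%R, x]) g s)%R.

(** The iterate, its dual variables and the inserted atom are functions of the
    data recorded at step k: the active set [A k], the weights [lam k], the
    affine part [l k] and the chosen maximum points [xS k], [xK k]. *)
Section Algorithm.
Variables (T alpha beta : R) (f : (R -> R) -> R) (gradf : (R -> R) -> R -> R).
Variables (A : nat -> {fset (R -> R)}) (lam : nat -> (R -> R) -> R).
Variables (l : nat -> R -> R) (xS xK : nat -> R).

Definition iterate k : R -> R := combination (A k) (lam k) (l k).

Definition pk k : R -> R := primitive (gradf (iterate k)).

Definition Pk k : R -> R := fun x => - primitive (pk k) x.

Definition stops k : Prop := normC T (pk k) <= alpha /\ normC T (Pk k) <= beta.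

Definition new_atom k : R -> R :=
  if normC T (pk k) / alpha >= normC T (Pk k) / beta
  then (Num.sg (pk k (xS k)) / alpha) *: Sfun T (xS k)
  else (Num.sg (Pk k (xK k)) / beta) *: Kfun T (xK k).

Definition enlarged k : {fset (R -> R)} := A k `|` [fset new_atom k].

(** [lam 0] and [l 0] play no role. *)
Record nonterminating_run : Prop := {
  run_init : forall v, v \in A 0%N -> ExtB T alpha beta v;
  run_min1 : minimizerP f (A 0%N) (lam 1%N) (l 1%N);
  run_prune1 : A 1%N = prune (A 0%N) (lam 1%N);
  run_xS : forall k, (1 <= k)%N ->
    0 < xS k < T /\ `|pk k (xS k)| = normC T (pk k);
  run_xK : forall k, (1 <= k)%N ->
    0 < xK k < T /\ `|Pk k (xK k)| = normC T (Pk k);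
  run_continues : forall k, (1 <= k)%N -> ~ stops k;
  run_min : forall k, (1 <= k)%N -> minimizerP f (enlarged k) (lam k.+1) (l k.+1);
  run_prune : forall k, (1 <= k)%N -> A k.+1 = prune (enlarged k) (lam k.+1) }.

Definition residual k : R :=
  f (iterate k) + \sum_(v <- A k) lam k v - minJ T f alpha beta.

Definition violation (Cf : R) k : R :=
  (f 0 + Cf) *
  (Num.max (normC T (pk k) / alpha) (normC T (Pk k) / beta) - 1).

End Algorithm.
End Spaces.

(* Main.v *)
(** Write g = grad f(u_k). Optimality of u_k for its finite problem says that g is
    orthogonal to the affine functions and <g, u_k> = - sum lam, so p = p_k and
    P = P_k vanish at both ends of (0,T). Integrating by parts twice,
    <g, u> = - (Du - w)(p) - Dw(P) for all u and w in BV(0,T), and hence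
    |<g, u>| <= max(|p|_C / alpha, |P|_C / beta) TGV(u), with equality (up to the
    sign) for the inserted atom. Together with convexity this gives
    r_k <= Psi_k; a step of length s from u_k towards M0 times the inserted atom
    and the descent lemma give r_(k+1) <= r_k - s Psi_k + 2 L C^2 s^2, and a
    suitable s yields the rate. TGV(u_k) <= sum lam holds because TGV is at
    most 1 on the atoms, and minimizers of J are not needed: competitors u with
    J(u) > J(0) are replaced by 0.

    The integration by parts is first known for test functions in C_c^oo only.
    It extends to p and P because C_c^oo is dense in C_0 and in L^1, and because
    a function of bounded variation is essentially bounded: the difference of
    its values at two Lebesgue points is a limit of values of its distributional
    derivative on test functions bounded by 1. *)
Require Import Defs.
From mathcomp Require Import all_boot all_order all_algebra finmap.
From mathcomp Require Import all_classical all_reals all_analysis.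
From mathcomp Require Import measurable_realfun ring lra.
Import Order.TTheory GRing.Theory Num.Theory.
Import numFieldNormedType.Exports.
Local Open Scope classical_set_scope.
Local Open Scope ring_scope.
Set Implicit Arguments.
Unset Strict Implicit.
Unset Printing Implicit Defensive.

(** * Smooth step functions *)

Section Smooth.
Context {R : realType}.
Implicit Types (f g df : R -> R) (a b x : R) (n : nat).

(* Unlike [derive1n], this form is stable under products and inverses by a plain induction. *)
Fixpoint diff_n n f : Prop :=
  if n is m.+1 then exists2 df, (forall x, is_derive x 1 f (df x)) & diff_n m df
  else True.

Definition smooth f := forall n, diff_n n f.

Lemma diff_n_pred n f : diff_n n.+1 f -> diff_n n f.
Proof.
elim: n f => // n IH f [df fdf dfn]; exists df => //; exact: IH.
Qed.

Lemma diff_n_derivable n f x : diff_n n.+1 f -> derivable (derive1n n f) x 1.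
Proof.
elim: n f => [f [df fdf _]|n IH f [df fdf dfn]]; first by have [] := fdf x.
rewrite derive1Sn (_ : derive1 f = df); first exact: IH.
by apply/funext => y; rewrite derive1E derive_val.
Qed.

Lemma diff_n_cst n c : diff_n n (fun=> c : R).
Proof. by elim: n c => // n IH c; exists (fun=> 0) => // x; exact: is_derive_cst. Qed.

Lemma diff_nD n f g : diff_n n f -> diff_n n g -> diff_n n (fun x => f x + g x).
Proof.
elim: n f g => // n IH f g [df fdf dfn] [dg gdg dgn].
by exists (fun x => df x + dg x); [move=> x; exact: (is_deriveD (fdf x) (gdg x))|exact: IH].
Qed.

Lemma diff_nM n f g : diff_n n f -> diff_n n g -> diff_n n (fun x => f x * g x).
Proof.
elim: n f g => // n IH f g fn gn.
have [df fdf dfn] := fn; have [dg gdg dgn] := gn.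
exists (fun x => f x * dg x + g x * df x); first by move=> x; exact: (is_deriveM (fdf x) (gdg x)).
by apply: diff_nD; apply: IH => //; exact: diff_n_pred.
Qed.

Lemma diff_n_affine n f a b :
  diff_n n f -> diff_n n (fun x => f (a * x + b)).
Proof.
elim: n f => // n IH f [df fdf dfn].
exists (fun x => df (a * x + b) * a); last first.
  apply: diff_nM; [exact: IH|exact: diff_n_cst].
move=> x; apply: (is_derive1_comp (g := fun x => a * x + b)).
have /is_derive_eq := is_deriveD (is_deriveZ a (is_derive_id x (1 : R))) (is_derive_cst b x 1).
by apply; rewrite addr0 [_ *: _]mulr1.
Qed.

Lemma diff_nV n f : (forall x, f x != 0) -> diff_n n f ->
  diff_n n (fun x => (f x)^-1).
Proof.
move=> f0; elim: n => // n IH fn.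
have /IH fVn := diff_n_pred fn; have [df fdf dfn] := fn.
exists (fun x => (-1) * (((f x)^-1 * (f x)^-1) * df x)); last first.
  by do !apply: diff_nM => //; exact: diff_n_cst.
move=> x; have /is_derive_eq := @is_deriveV _ f x (df x) 1 (f0 x) (fdf x).
by apply; rewrite mulN1r [_ *: _]mulNr -exprVn expr2.
Qed.

Lemma diff_n_sum n (N : nat) (F : nat -> R -> R) : (forall i, diff_n n (F i)) ->
  diff_n n (fun x => \sum_(i < N) F i x).
Proof.
move=> Fn; elim: N => [|N IH].
  rewrite (_ : (fun _ => _) = fun=> 0); first exact: diff_n_cst.
  by apply/funext => x; rewrite big_ord0.
rewrite (_ : (fun _ => _) = fun x => \sum_(i < N) F i x + F N x).
  exact: diff_nD.
by apply/funext => x; rewrite big_ord_recr.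
Qed.

Lemma is_derive_quadratic f c : (forall x, `|f x| <= c * x ^+ 2) ->
  is_derive (0 : R) 1 f 0.
Proof.
move=> fc.
have f0 : f 0 = 0.
  by apply/eqP; rewrite -normr_le0 (le_trans (fc 0))// expr2 !mulr0.
have c0 : 0 <= c by have := fc 1; rewrite expr1n mulr1; exact: le_trans.
have h : h^-1 *: ((f \o shift 0) (h *: 1) - f 0) @[h --> 0^'] --> (0 : R).
  apply/cvgrPdist_le => /= e e0.
  near=> t; have t0 : t != 0 by near: t; exact: nbhs_dnbhs_neq.
  rewrite sub0r normrN /= f0 subr0 addr0 [t *: 1]mulr1 normrZ normfV.
  rewrite mulrC ler_pdivrMr ?normr_gt0//.
  apply: (le_trans (fc t)); rewrite -real_normK ?num_real// expr2 mulrA.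
  rewrite ler_wpM2r//.
  have : `|t| <= e / (c + 1).
    near: t; apply: dnbhs0_le; apply: divr_gt0 => //.
    by rewrite ltr_wpDl.
  rewrite ler_pdivlMr ?ltr_wpDl// => /(le_trans _); apply.
  by rewrite mulrDr mulr1 mulrC lerDl.
apply: DeriveDef; first by apply/cvg_ex; exists 0.
exact: cvg_lim h.
Unshelve. all: by end_near. Qed.

(* The span of these functions is closed under differentiation, which makes all of them smooth. *)
Definition flat n (x : R) : R := if 0 < x then x ^- n * expR (- x^-1) else 0.

Lemma flat_ge0 n x : 0 <= flat n x.
Proof.
by rewrite /flat; case: ifP => // x0; rewrite mulr_ge0 ?expR_ge0// invr_ge0 exprn_ge0// ltW.
Qed.

Lemma flat_le n x : `|flat n x| <= (n.+2)`!%:R * x ^+ 2.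
Proof.
rewrite ger0_norm ?flat_ge0// /flat; case: ifPn => [x0|_]; last first.
  by rewrite mulr_ge0 ?sqr_ge0.
have y0 : 0 < x^-1 by rewrite invr_gt0.
rewrite expRN ler_pdivrMr ?expR_gt0// -exprVn.
have := expR_ge1Dxn n.+1 (ltW y0) => h.
have {}h : x^-1 ^+ n.+2 / (n.+2)`!%:R <= expR x^-1 by rewrite (le_trans _ h)// lerDr.
rewrite ler_pdivrMr ?ltr0n ?fact_gt0// in h.
have -> : x^-1 ^+ n = x^-1 ^+ n.+2 * x ^+ 2.
  by rewrite -addn2 exprD -mulrA -exprMn mulVf ?gt_eqF// expr1n mulr1.
by rewrite [leRHS]mulrAC ler_pM2r ?exprn_gt0// mulrC.
Qed.

Lemma is_derive_flat n x :
  is_derive x 1 (flat n) (- n%:R * flat n.+1 x + flat n.+2 x).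
Proof.
have [x0|x0|->] := ltgtP x 0.
- rewrite /flat ltNge (ltW x0)/= mulr0 addr0.
  apply: near_eq_is_derive (is_derive_cst 0 x 1).
  near=> y; rewrite ltNge (_ : y <= 0)//; apply: ltW.
  by near: y; exact: lt_nbhsl.
- rewrite {2 3}/flat x0.
  apply: (near_eq_is_derive (f := fun y : R => y^-1 ^+ n * expR (- y^-1))).
    near=> y; rewrite /flat (_ : 0 < y) ?exprVn//.
    by near: y; exact: lt_nbhsr.
  have xn0 : x != 0 by rewrite gt_eqF.
  have dV : is_derive x 1 (fun y : R => y^-1) (- x ^- 2).
    have /is_derive_eq := @is_deriveV _ id x 1 1 xn0 (is_derive_id _ _).
    by apply; rewrite [_ *: _]mulr1.
  have dE : is_derive x 1 (fun y : R => expR (- y^-1)) (expR (- x^-1) * x ^- 2).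
    apply: (is_derive1_comp (f := expR) (g := fun y : R => - y^-1)).
    by apply: is_derive_eq; rewrite opprK.
  have dX : is_derive x 1 (fun y : R => y^-1 ^+ n)
      ((n%:R * x^-1 ^+ n.-1) *: (- x ^- 2)).
    rewrite (_ : (fun _ => _) = (fun y : R => y^-1) ^+ n).
      exact: is_deriveX.
    by apply/funext => y; rewrite exprfctE.
  have /is_derive_eq := is_deriveM dX dE; apply.
  rewrite /GRing.scale/= -!exprVn.
  move: (expR (- x^-1)) => e; set y := x^-1.
  case: n {dX} => [|n] /=; first by rewrite mulr0n; ring.
  by rewrite -mulr_natr !exprS; ring.
- rewrite /flat ltxx mulr0 addr0; exact: is_derive_quadratic (flat_le n).
Unshelve. all: by end_near. Qed.

Lemma diff_n_flat m n : diff_n m (flat n).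
Proof.
elim: m n => // m IH n; exists (fun x => - n%:R * flat n.+1 x + flat n.+2 x).
  exact: is_derive_flat.
by apply: diff_nD => //; apply: diff_nM => //; exact: diff_n_cst.
Qed.

Definition step x : R := flat 0 x / (flat 0 x + flat 0 (1 - x)).

Lemma step_den_gt0 x : 0 < flat 0 x + flat 0 (1 - x).
Proof.
have flat_gt0 y : 0 < y -> 0 < flat 0 y.
  by move=> y0; rewrite /flat y0 expr0 invr1 mul1r expR_gt0.
have [x0|x0] := ltP 0 x; first by rewrite ltr_pwDl ?flat_gt0 ?flat_ge0.
by rewrite ltr_wpDl ?flat_ge0// flat_gt0//; lra.
Qed.

Lemma step_smooth : smooth step.
Proof.
move=> n; apply: diff_nM; first exact: diff_n_flat.
apply: diff_nV; first by move=> x; rewrite gt_eqF ?step_den_gt0.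
apply: diff_nD; first exact: diff_n_flat.
rewrite (_ : (fun _ => _) = (fun x => flat 0 ((-1) * x + 1))).
  exact/diff_n_affine/diff_n_flat.
by apply/funext => x; congr flat; ring.
Qed.

Lemma step_itv x : 0 <= step x <= 1.
Proof.
have d0 := step_den_gt0 x.
by rewrite /step divr_ge0 ?flat_ge0 ?(ltW d0)//= ler_pdivrMr// mul1r lerDl flat_ge0.
Qed.

Lemma step_le0 x : x <= 0 -> step x = 0.
Proof. by move=> x0; rewrite /step {1}/flat ltNge x0/= mul0r. Qed.

Lemma step_ge1 x : 1 <= x -> step x = 1.
Proof.
move=> x1; have := step_den_gt0 x; rewrite /step.
have -> : flat 0 (1 - x) = 0 by rewrite /flat ltNge subr_le0 x1.
by rewrite addr0 => x0; rewrite divff ?gt_eqF.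
Qed.

End Smooth.

(** * Integration over (0,T) *)

Section RestrictedMeasure.
Context d (X : measurableType d) {R : realType}.
Variables (mu : {measure set X -> \bar R}) (D : set X) (mD : measurable D).
Implicit Types f g : X -> \bar R.
Local Open Scope ereal_scope.

Import HBNNSimple.

Lemma sintegral_mrestr (h : {nnsfun X >-> R}) :
  sintegral (mrestr mu mD) h = sintegral mu (h \_ D).
Proof.
rewrite /sintegral; apply: eq_fsbigr => x _.
have [->|x0] := eqVneq x 0%R; first by rewrite !mul0e.
congr (_ * mu _); apply/seteqP; split => y /=.
  by move=> [<- Dy]; rewrite patchE mem_set.
rewrite patchE; case: ifPn; first by rewrite inE.
by move=> _ /esym/eqP; rewrite (negbTE x0).
Qed.

Lemma ge0_integral_mrestr f : (forall x, 0 <= f x) ->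
  \int[mrestr mu mD]_x f x = \int[mu]_(x in D) f x.
Proof.
move=> f0; rewrite !ge0_integralE//; apply/eqP; rewrite eq_le; apply/andP; split.
- apply: ge_ereal_sup => _ [h hf <-]; apply: ereal_sup_ubound => /=.
  exists (proj_nnsfun h mD); last by rewrite sintegral_mrestr mrestrict.
  move=> x; rewrite -mrestrict !patchE; case: ifPn => // _.
  by have := hf x; rewrite patch_setT.
- apply: ge_ereal_sup => _ [h hf <-]; apply: ereal_sup_ubound => /=.
  exists h.
    move=> x; rewrite patch_setT (le_trans (hf x))// patchE; case: ifPn => //.
  rewrite sintegral_mrestr; congr sintegral; apply/funext => x.
  rewrite patchE; case: ifPn => // xD; apply/esym/le_anti.
  by have := hf x; rewrite patchE (negbTE xD) lee_fin => ->/=; exact: fun_ge0.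
Qed.

(* Measurability is not assumed: elements of [C0 T] may be arbitrary outside of (0,T). *)
Lemma integral_mrestr f : \int[mrestr mu mD]_x f x = \int[mu]_(x in D) f x.
Proof.
by rewrite [LHS]integralE [RHS]integralE !ge0_integral_mrestr.
Qed.

Lemma Rintegral_mrestr (f : X -> R) :
  (\int[mrestr mu mD]_x f x = \int[mu]_(x in D) f x)%R.
Proof. by rewrite /Rintegral integral_mrestr. Qed.

End RestrictedMeasure.

Section RealIntegrable.
Context d (X : measurableType d) {R : realType}.
Variables (mu : {measure set X -> \bar R}) (E : set X) (mE : measurable E).
Implicit Types (f g : X -> R) (a M : R).

Local Notation intg f := (mu.-integrable E (EFin \o f)).

Lemma eq_intg f g : (forall x, E x -> f x = g x) -> intg f -> intg g.
Proof.
by move=> fg; apply: eq_integrable => // x /[!inE] Ex /=; rewrite fg.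
Qed.

Lemma intg_measurable f : intg f -> measurable_fun E f.
Proof. by move=> /integrableP[/measurable_EFinP]. Qed.

Lemma intgD f g : intg f -> intg g -> intg (fun x => f x + g x).
Proof. by move=> fi gi; exact: integrableD fi gi. Qed.

Lemma intgZ a f : intg f -> intg (fun x => a * f x).
Proof. by move=> fi; exact: integrableZl fi. Qed.

Lemma intgB f g : intg f -> intg g -> intg (fun x => f x - g x).
Proof. by move=> fi gi; exact: integrableB fi gi. Qed.

Lemma intg_norm f : intg f -> intg (fun x => `|f x|).
Proof. by move=> fi; exact: integrable_norm fi. Qed.

Lemma intgM f g M : intg f -> measurable_fun E g ->
  (forall x, E x -> `|g x| <= M) -> intg (fun x => f x * g x).
Proof.
move=> fi mg gM; apply: integrableMl fi mg _ => //.
by exists M; split; [exact: num_real|move=> y My x Ex /=; rewrite (le_trans (gM x Ex))// ltW].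
Qed.

Lemma intg_bounded f M : (mu E < +oo)%E -> measurable_fun E f ->
  (forall x, E x -> `|f x| <= M) -> intg f.
Proof.
move=> E_fin mf fM; apply: measurable_bounded_integrable => //.
by exists M; split; [exact: num_real|move=> y My x Ex /=; rewrite (le_trans (fM x Ex))// ltW].
Qed.

Lemma normr_RintegralM_le f g M : intg f -> measurable_fun E g ->
  (forall x, E x -> `|g x| <= M) ->
  `|\int[mu]_(x in E) (f x * g x)| <= (\int[mu]_(x in E) `|f x|) * M.
Proof.
move=> fi mg gM; have fgi := intgM fi mg gM.
apply: (le_trans (le_normr_Rintegral mE fgi)).
rewrite mulrC -RintegralZl//; last exact: intg_norm.
apply: le_Rintegral => //; [exact: intg_norm|exact/intgZ/intg_norm|].
by move=> x Ex; rewrite normrM mulrC ler_wpM2r// gM.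
Qed.

End RealIntegrable.

Section Interval.
Context {R : realType}.
Variable T : R.
Implicit Types (u v w g h phi psi : R -> R).

Local Notation mu := (@lebesgue_measure R).
Local Notation D := (`]0, T[%classic : set R).
Local Notation intg u := (mu.-integrable D (EFin \o u)).

Lemma dotL2E u v : dotL2 T u v = \int[mu]_(x in D) (u x * v x).
Proof. exact: Rintegral_mrestr. Qed.

Lemma L1P u : L1 T u <-> measurable_fun setT u /\ intg u.
Proof.
rewrite /L1/=; split=> [/Lfun1_integrable/integrableP[mu' iu]|[mu' /integrableP[_ iu]]].
  split; first exact/measurable_EFinP.
  apply/integrableP; split; first exact: measurable_funTS.
  by move: iu; rewrite integral_mrestr.
apply/Lfun1_integrable/integrableP; split; first exact/measurable_EFinP.
by rewrite integral_mrestr.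
Qed.

Lemma muT_finite : (muT T setT < +oo)%E.
Proof.
rewrite /muT /= /mrestr setTI; have [T0|T0] := ltP 0 T; last first.
  by rewrite set_itv_ge ?measure0// -leNgt bnd_simp.
by rewrite lebesgue_measure_itv/= lte_fin T0 -EFinD ltry.
Qed.

Lemma muD_finite : (mu D < +oo)%E.
Proof. by have := muT_finite; rewrite /muT /= /mrestr setTI. Qed.

Lemma L2_L1 u : L2 T u -> L1 T u.
Proof. by apply: Lfun_subset12; rewrite ge0_fin_numE// muT_finite. Qed.

Lemma L2_intg u : L2 T u -> intg u.
Proof. by move=> /L2_L1/L1P[]. Qed.

Lemma L2_mul_intg u v : L2 T u -> L2 T v -> intg (fun x => u x * v x).
Proof.
move=> uL vL; have : L1 T (fun x => u x * v x) by exact: Lfun2_mul_Lfun1.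
by move=> /L1P[].
Qed.

Lemma L2_lin a u v : L2 T u -> L2 T v -> L2 T (a *: u + v).
Proof.
move=> uL vL.
have h : (1 <= (2%:E : \bar R))%E by rewrite lee_fin ler1n.
have [_] := Lfun_submod_closed (muT T) h; exact.
Qed.

Lemma L2_0 : L2 T 0.
Proof.
have h : (1 <= (2%:E : \bar R))%E by rewrite lee_fin ler1n.
by have [] := Lfun_submod_closed (muT T) h.
Qed.

Lemma L2_scale a u : L2 T u -> L2 T (a *: u).
Proof. by move=> uL; rewrite -[_ *: _]addr0; apply: L2_lin => //; exact: L2_0. Qed.

Lemma L2_add u v : L2 T u -> L2 T v -> L2 T (u + v).
Proof. by move=> uL vL; rewrite -[u]scale1r; exact: L2_lin. Qed.

Lemma L2_opp u : L2 T u -> L2 T (- u).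
Proof. by move=> uL; rewrite -scaleN1r; exact: L2_scale. Qed.

Lemma L2_sub u v : L2 T u -> L2 T v -> L2 T (u - v).
Proof. by move=> uL vL; apply: L2_add => //; exact: L2_opp. Qed.

Lemma L2_bounded u M : measurable_fun setT u ->
  {ae muT T, forall x, `|u x| <= M} -> L2 T u.
Proof.
move=> um uM; rewrite /L2/= inE; apply/andP; split; rewrite inE//=.
rewrite /finite_norm unlock /Lnorm poweR_lty//.
apply: (@le_lt_trans _ _ (\int[muT T]_x (M `^ 2)%:E)%E); last first.
  by rewrite integral_cst// lte_mul_pinfty ?lee_fin ?powR_ge0// muT_finite.
apply: ae_ge0_le_integral => //.
- by move=> x _; rewrite lee_fin powR_ge0.
- apply/measurable_EFinP.
  apply: (@measurableT_comp _ _ _ _ _ _ (@powR R ^~ 2)) => //.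
  exact: measurableT_comp.
- by move=> x _; rewrite lee_fin powR_ge0.
- have := uM; apply: (@filterS _ _ (ae_filter_ringOfSetsType (muT T))) => t/= ftM _.
  rewrite lee_fin ge0_ler_powR//.
  by rewrite nnegrE (le_trans _ ftM).
Qed.

Lemma dotL2C u v : dotL2 T u v = dotL2 T v u.
Proof. by rewrite !dotL2E; apply: eq_Rintegral => x _; rewrite mulrC. Qed.

Lemma dotL2_linl a u v w : intg (fun x => u x * w x) -> intg (fun x => v x * w x) ->
  dotL2 T (a *: u + v) w = a * dotL2 T u w + dotL2 T v w.
Proof.
move=> uw vw; rewrite !dotL2E -RintegralZl// -RintegralD//.
  by apply: eq_Rintegral => x _; rewrite fctE/= mulrDl mulrA.
exact: intgZ.
Qed.

Lemma dotL2_linr a u v w : intg (fun x => w x * u x) -> intg (fun x => w x * v x) ->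
  dotL2 T w (a *: u + v) = a * dotL2 T w u + dotL2 T w v.
Proof.
move=> wu wv; rewrite !(dotL2C w) dotL2_linl//.
- by apply: eq_intg wu => // x _; rewrite mulrC.
- by apply: eq_intg wv => // x _; rewrite mulrC.
Qed.

Lemma dotL2_ge0 u : 0 <= dotL2 T u u.
Proof. by rewrite dotL2E; apply: Rintegral_ge0 => x _; rewrite -expr2 sqr_ge0. Qed.

Lemma normL2E u : normL2 T u = Num.sqrt (dotL2 T u u).
Proof.
rewrite /normL2 unlock /Lnorm /= fine_poweR powR12_sqrt; last first.
  by rewrite fine_ge0//; apply: integral_ge0 => x _; rewrite lee_fin powR_ge0.
congr (Num.sqrt (fine _)); apply: eq_integral => x _ /=.
by rewrite powR_mulrn ?normr_ge0// real_normK ?num_real// expr2.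
Qed.

Lemma normL2_ge0 u : 0 <= normL2 T u.
Proof. by rewrite normL2E sqrtr_ge0. Qed.

Lemma normL2_sqr u : normL2 T u ^+ 2 = dotL2 T u u.
Proof. by rewrite normL2E sqr_sqrtr// dotL2_ge0. Qed.

Lemma dotL2_sqr_lin a u v : L2 T u -> L2 T v ->
  dotL2 T (a *: u + v) (a *: u + v) =
  a ^+ 2 * dotL2 T u u + 2 * a * dotL2 T u v + dotL2 T v v.
Proof.
move=> uL vL; have wL := L2_lin a uL vL.
rewrite dotL2_linl; [|exact: L2_mul_intg|exact: L2_mul_intg].
rewrite !dotL2_linr; try exact: L2_mul_intg.
by rewrite (dotL2C v u); ring.
Qed.

Lemma normL2Z a u : L2 T u -> normL2 T (a *: u) = `|a| * normL2 T u.
Proof.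
move=> uL; rewrite !normL2E -[a *: u]addr0 dotL2_sqr_lin//; last exact: L2_0.
have z w : dotL2 T w 0 = 0.
  by rewrite dotL2E -[RHS](mul0r (fine (mu D))) -Rintegral_cst//; apply: eq_Rintegral => x _; rewrite mulr0.
by rewrite !z mulr0 !addr0 sqrtrM ?sqr_ge0// sqrtr_sqr.
Qed.

Lemma cauchy_schwarz u v : L2 T u -> L2 T v ->
  `|dotL2 T u v| <= normL2 T u * normL2 T v.
Proof.
move=> uL vL; rewrite -(ler_pXn2r (ltn0Sn 1)) ?nnegrE ?mulr_ge0 ?normL2_ge0//.
rewrite exprMn !normL2_sqr real_normK ?num_real//.
have P a : 0 <= a ^+ 2 * dotL2 T u u + 2 * a * dotL2 T u v + dotL2 T v v.
  by rewrite -dotL2_sqr_lin// dotL2_ge0.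
have u0 := dotL2_ge0 u.
move: (dotL2 T u u) (dotL2 T v v) (dotL2 T u v) P u0 => p q b P p0.
have [p_eq0|pn0] := eqVneq p 0.
  have [->|b0] := eqVneq b 0; first by rewrite expr0n/= p_eq0 mul0r.
  have := P (- (q + 1) / (2 * b)).
  rewrite p_eq0 mulr0 add0r (_ : 2 * _ * b = - (q + 1)); first by lra.
  by field.
have pp : 0 < p by rewrite lt_def pn0.
have := P (- b / p).
rewrite (_ : _ + q = (p * q - b ^+ 2) / p); last by field.
by rewrite pmulr_lge0 ?invr_gt0// subr_ge0.
Qed.

Lemma normL2D u v : L2 T u -> L2 T v ->
  normL2 T (u + v) <= normL2 T u + normL2 T v.
Proof.
move=> uL vL; rewrite -(ler_pXn2r (ltn0Sn 1)) ?nnegrE ?addr_ge0 ?normL2_ge0//.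
have := dotL2_sqr_lin 1 uL vL; rewrite scale1r => uv; rewrite normL2_sqr uv.
rewrite -!normL2_sqr.
have := le_trans (ler_norm _) (cauchy_schwarz uL vL).
move: (normL2 T u) (normL2 T v) (dotL2 T u v) => a b c; nra.
Qed.

End Interval.

Lemma near_cst_cvg {U : topologicalType} {X : Type} (F : set_system X)
  {FF : Filter F} (f : X -> U) (c : U) :
  (\near F, f F = c) -> f x @[x --> F] --> c.
Proof.
move=> fc; apply: cvg_trans (cvg_cst (F := F) c); apply: near_eq_cvg.
by apply: filterS fc => x ->.
Qed.

Lemma continuous_unif_segment {R : realType} (f : R -> R) (a b e : R) :
  continuous f -> 0 < e -> exists2 d, 0 < d &
  forall x y, a <= x <= b -> `|x - y| < d -> `|f x - f y| <= e.
Proof.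
move=> cf e0.
pose P (d x : R) := forall y, `|x - y| < d -> `|f x - f y| <= e.
have : \forall d \near 0^'+, `[a, b]%classic `<=` P d.
  apply: (compact_near_coveringP _).1; first exact: segment_compact.
  move=> x _.
  have /cvgrPdist_le/(_ (e / 2) (divr_gt0 e0 (ltr0Sn _ 1))) := cf x.
  move=> /nbhs_ballP[d /= d0 dP].
  exists (ball x (d / 2), [set t | t < d / 2]); first split => /=.
  - by apply: nbhsx_ballx; rewrite divr_gt0.
  - by apply: nbhs_right_lt; rewrite divr_gt0.
  move=> [z t] [/= xz td] y zy.
  have h w : `|x - w| < d -> `|f x - f w| <= e / 2 by exact: dP.
  rewrite (le_trans (ler_distD (f x) _ _))// [e]splitr lerD//.
    rewrite distrC h// (lt_trans xz)// gtr_pMr//; lra.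
  rewrite h// (le_lt_trans (ler_distD z _ _))// [d]splitr ltrD// (lt_trans zy)//.
move=> H; have [d [d0 dP]] : exists d : R, 0 < d /\ `[a, b]%classic `<=` P d.
  have G : \forall d \near 0^'+, 0 < d /\ `[a, b]%classic `<=` P d.
    by near=> d; split; near: d => //; exact: nbhs_right_gt.
  exact: filter_ex G.
exists d => // x y xab; apply: dP; rewrite /= in_itv/=; exact: xab.
Unshelve. all: by end_near. Qed.

Lemma continuous_bounded_segment {R : realType} (f : R -> R) (a b : R) :
  continuous f -> exists M, forall x, a <= x <= b -> `|f x| <= M.
Proof.
move=> cf; have cw : {within `[a, b], continuous f}.
  exact: continuous_subspaceT.
have /compact_bounded[M [_ mrt]] := continuous_compact cw (@segment_compact _ a b).
exists (M + 1) => x xab; apply: (mrt (M + 1)); first by rewrite ltrDl.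
by exists x => //=; rewrite in_itv/=.
Qed.

Section Dual.
Context {R : realType}.
Variable T : R.
Hypothesis T_gt0 : 0 < T.
Implicit Types (u v w g h phi psi : R -> R) (x y : R).

Local Notation mu := (@lebesgue_measure R).
Local Notation D := (`]0, T[%classic : set R).
Local Notation intg u := (mu.-integrable D (EFin \o u)).

Lemma half_itv : 0 < T / 2 < T.
Proof. by rewrite divr_gt0//= ltr_pdivrMr// ltr_pMr// ltr1n. Qed.

Definition zext phi : R -> R := fun x => if 0 < x < T then phi x else 0.

Lemma zextE phi x : 0 < x < T -> zext phi x = phi x.
Proof. by rewrite /zext => ->. Qed.

Lemma zext_continuous phi : C0 T phi -> continuous (zext phi).
Proof.
move=> [cphi phi0 phiT] x; rewrite /continuous_at.
have [x0|x0|->] := ltgtP x 0.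
- have -> : zext phi x = 0 by rewrite /zext ltNge (ltW x0).
  apply: near_cst_cvg; near=> y; rewrite /zext ltNge (_ : y <= 0)//.
  by apply: ltW; near: y; exact: lt_nbhsl.
- have [xT|xT|xT] := ltgtP x T.
  + have xD : x \in `]0, T[ by rewrite in_itv/= x0.
    rewrite (zextE _ (introT andP (conj x0 xT))).
    apply: cvg_trans (cphi x xD); apply: near_eq_cvg.
    near=> y; rewrite zextE//; apply/andP; split.
      by near: y; exact: lt_nbhsr.
    by near: y; exact: lt_nbhsl.
  + have -> : zext phi x = 0 by rewrite /zext (ltNge x) (ltW xT) andbF.
    apply: near_cst_cvg; near=> y; rewrite /zext (ltNge y) (_ : T <= y) ?andbF//.
    by apply: ltW; near: y; exact: lt_nbhsr.
  + apply/left_right_continuousP.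
    have -> : zext phi x = 0 by rewrite /zext xT ltxx andbF.
    rewrite xT; split.
      apply: cvg_trans phiT; apply: near_eq_cvg.
      near=> y; rewrite zextE//; apply/andP; split; first by near: y; exact: nbhs_left_gt.
      by near: y; exact: nbhs_left_lt.
    apply: near_cst_cvg; near=> y; rewrite /zext (ltNge y) (_ : T <= y) ?andbF//.
- apply/left_right_continuousP.
  have -> : zext phi 0 = 0 by rewrite /zext ltxx.
  split.
    apply: near_cst_cvg; near=> y; rewrite /zext ltNge (_ : y <= 0)//.
  apply: cvg_trans phi0; apply: near_eq_cvg.
  near=> y; rewrite zextE//; apply/andP; split; first by near: y; exact: nbhs_right_gt.
  by near: y; exact: nbhs_right_lt.
Unshelve. all: by end_near. Qed.

Lemma C0_of_continuous phi : continuous phi -> phi 0 = 0 -> phi T = 0 -> C0 T phi.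
Proof.
move=> cphi p0 pT; split; first by move=> x _; exact: cphi.
- by have /left_right_continuousP[_] := cphi 0; rewrite p0.
- by have /left_right_continuousP[+ _] := cphi T; rewrite pT.
Qed.

Lemma C0_lin a phi psi : C0 T phi -> C0 T psi -> C0 T (a *: phi + psi).
Proof.
move=> [cp p0 pT] [cq q0 qT]; split.
- by move=> x xD; apply: cvgD; [apply: cvgZl_tmp; exact: cp|exact: cq].
- rewrite -[X in _ --> X]addr0 -[X in _ --> X + _](scaler0 _ a).
  by apply: cvgD => //; exact: cvgZl_tmp.
- rewrite -[X in _ --> X]addr0 -[X in _ --> X + _](scaler0 _ a).
  by apply: cvgD => //; exact: cvgZl_tmp.
Qed.

Lemma C0_0 : C0 T 0.
Proof. by apply: C0_of_continuous => //; exact: cst_continuous. Qed.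

Lemma C0_scale a phi : C0 T phi -> C0 T (a *: phi).
Proof. by move=> c; rewrite -[_ *: _]addr0; apply: C0_lin => //; exact: C0_0. Qed.

Lemma C0_sub phi psi : C0 T phi -> C0 T psi -> C0 T (phi - psi).
Proof. by move=> cp cq; rewrite addrC -scaleN1r; exact: C0_lin. Qed.

Lemma C0_ubound phi : C0 T phi -> has_ubound [set `|phi x| | x in `]0, T[].
Proof.
move=> /zext_continuous/(continuous_bounded_segment 0 T)[M hM].
exists M => _ [x /= xD <-]; move: xD; rewrite in_itv/= => /andP[x0 xT].
by rewrite -(@zextE phi x) ?x0//; apply: hM; rewrite !ltW.
Qed.

Lemma normC_ge phi x : C0 T phi -> 0 < x < T -> `|phi x| <= normC T phi.
Proof.
by move=> c xD; apply: ub_le_sup; [exact: C0_ubound|exists x => //=; rewrite in_itv].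
Qed.

Lemma normC_le phi M : (forall x, 0 < x < T -> `|phi x| <= M) -> normC T phi <= M.
Proof.
move=> h; apply: ge_sup.
  by exists `|phi (T / 2)|, (T / 2) => //=; rewrite in_itv/= half_itv.
by move=> _ [x /= xD <-]; apply: h; move: xD; rewrite in_itv.
Qed.

Lemma normC_ge0 phi : C0 T phi -> 0 <= normC T phi.
Proof.
move=> c; apply: (le_trans (normr_ge0 (phi (T / 2)))); apply: normC_ge => //.
exact: half_itv.
Qed.

Lemma normCZ_le a phi : C0 T phi -> normC T (a *: phi) <= `|a| * normC T phi.
Proof.
by move=> c; apply: normC_le => x xD; rewrite normrM ler_wpM2l// normC_ge.
Qed.

Lemma C0_measurable phi : C0 T phi -> measurable_fun D phi.
Proof.
move=> c; apply: (@eq_measurable_fun _ _ _ _ _ (zext phi)).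
  by move=> x /[!inE]/=; rewrite in_itv/=; exact: zextE.
apply: measurable_funTS; apply: continuous_measurable_fun.
exact: zext_continuous.
Qed.

Lemma C0_bound phi : C0 T phi -> forall x, D x -> `|phi x| <= normC T phi.
Proof. by move=> c x /=; rewrite in_itv/= => xD; exact: normC_ge. Qed.

Lemma Ccinfty_continuous phi : Ccinfty T phi -> continuous phi.
Proof.
by move=> [/(_ 0%N) d _] x; apply/differentiable_continuous/derivable1_diffP; exact: d.
Qed.

Lemma Ccinfty_out phi x : Ccinfty T phi -> ~~ (0 < x < T) -> phi x = 0.
Proof.
move=> [_ [a [b [a0 bT h]]]] xD; apply/eqP/contraT => /h /andP[ax xb].
by move: xD; rewrite (lt_le_trans a0 ax) (le_lt_trans xb bT).
Qed.

Lemma Ccinfty_C0 phi : Ccinfty T phi -> C0 T phi.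
Proof.
move=> c; apply: C0_of_continuous; first exact: Ccinfty_continuous.
- by apply: Ccinfty_out c _; rewrite ltxx.
- by apply: Ccinfty_out c _; rewrite ltxx andbF.
Qed.

End Dual.

(** * Density of test functions *)

Section StepInterpolation.
Context {R : realType}.
Implicit Types (x h : R) (c : nat -> R).

(* Smooth interpolation: [c 0 +] this sum takes the value [c i] at the node [i * h]. *)
Definition step_sum h c (N : nat) x : R :=
  \sum_(i < N) (c i.+1 - c i) * step ((x - i%:R * h) / h).

Lemma step_sum_smooth h c N : smooth (step_sum h c N).
Proof.
move=> n; apply: (diff_n_sum N (F := fun i x => (c i.+1 - c i) * step ((x - i%:R * h) / h))) => i.
apply: diff_nM; first exact: diff_n_cst.
rewrite (_ : (fun _ => _) = fun x => step (h^-1 * x + - (i%:R * h / h))).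
  exact/diff_n_affine/step_smooth.
by apply/funext => x; congr step; ring.
Qed.

Lemma step_sum_before h c N j x : 0 < h -> (N <= j)%N -> j%:R * h <= x ->
  step_sum h c N x = c N - c 0%N.
Proof.
move=> h0 Nj jx; rewrite /step_sum; elim: N Nj => [|N IH] Nj.
  by rewrite big_ord0 subrr.
rewrite big_ord_recr /= IH ?(ltnW Nj)// step_ge1; first by ring.
rewrite ler_pdivlMr// mul1r lerBrDr (le_trans _ jx)//.
rewrite -{1}[h]mul1r -mulrDl ler_wpM2r ?(ltW h0)// addrC.
by rewrite natr1 ler_nat.
Qed.

Lemma step_sum_on h c N j x : 0 < h -> (j < N)%N ->
  j%:R * h <= x <= j.+1%:R * h ->
  step_sum h c N x = c j - c 0%N + (c j.+1 - c j) * step ((x - j%:R * h) / h).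
Proof.
move=> h0; elim: N => // N IH; rewrite ltnS leq_eqVlt => /predU1P[->|jN] /andP[jx xj].
  rewrite /step_sum big_ord_recr /=; congr (_ + _).
  exact: step_sum_before jx.
rewrite /step_sum big_ord_recr /= [X in _ * X]step_le0 ?mulr0 ?addr0; last first.
  rewrite pmulr_lle0 ?invr_gt0// subr_le0 (le_trans xj)// ler_wpM2r ?(ltW h0)//.
  by rewrite ler_nat.
by apply: IH => //; rewrite jx.
Qed.

End StepInterpolation.

Section Density.
Context {R : realType}.
Variable T : R.
Hypothesis T_gt0 : 0 < T.
Implicit Types (u v w g h phi psi : R -> R) (x y e : R).

Local Notation mu := (@lebesgue_measure R).
Local Notation D := (`]0, T[%classic : set R).
Local Notation intg u := (mu.-integrable D (EFin \o u)).

Lemma smooth_Ccinfty phi a b : smooth phi -> 0 < a -> b < T ->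
  (forall x, x <= a -> phi x = 0) -> (forall x, b <= x -> phi x = 0) ->
  Ccinfty T phi.
Proof.
move=> s a0 bT ha hb; split.
  by move=> n x; apply: diff_n_derivable; exact: s.
exists a, b; split => // x; apply: contraNT.
rewrite negb_and -!ltNge => /orP[/ltW/ha->//|/ltW/hb->//].
Qed.

(* The nodal values of the interpolation are set to 0 where phi is small, so that
   it vanishes near both ends. *)
Lemma Ccinfty_dense phi e : C0 T phi -> 0 < e ->
  exists2 psi, Ccinfty T psi & forall x, 0 < x < T -> `|phi x - psi x| <= e.
Proof.
move=> c e0; pose f := zext T phi.
have e20 : 0 < e / 2 by rewrite divr_gt0.
have [d d0 dP] := continuous_unif_segment 0 T (zext_continuous T_gt0 c) e20.
pose N := (Num.truncn (T / d)).+2; pose h := T / N%:R.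
have N0 : 0 < N%:R :> R by rewrite ltr0n.
have h0 : 0 < h by rewrite divr_gt0.
have hd : h < d.
  rewrite /h ltr_pdivrMr// mulrC -ltr_pdivrMr//.
  have /truncn_itv/andP[_ /lt_trans] : 0 <= T / d by rewrite divr_ge0 ?ltW.
  by apply; rewrite ltr_nat.
have NT : N%:R * h = T by rewrite /h mulrC divfK// gt_eqF.
have fclose j x : (j < N)%N -> j%:R * h <= x <= j.+1%:R * h ->
    `|f x - f (j%:R * h)| <= e / 2 /\ `|f x - f (j.+1%:R * h)| <= e / 2.
  move=> jN /andP[jx xj].
  have x0T : 0 <= x <= T.
    apply/andP; split; first by rewrite (le_trans _ jx)// mulr_ge0// ltW.
    by rewrite (le_trans xj)// -NT ler_wpM2r ?(ltW h0)// ler_nat.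
  rewrite -natr1 mulrDl mul1r in xj *.
  split; apply: dP => //; apply: le_lt_trans hd.
    by rewrite ger0_norm ?subr_ge0// lerBlDr addrC.
  by rewrite ler0_norm ?subr_le0// opprB lerBlDr; lra.
pose c_ i := if `|f (i%:R * h)| <= e / 2 then 0 else f (i%:R * h).
have c_close i : `|f (i%:R * h) - c_ i| <= e / 2.
  by rewrite /c_; case: ifPn => [|_]; [rewrite subr0|rewrite subrr normr0 ltW].
have f0 : f 0 = 0 by rewrite /f /zext ltxx.
have fT : f T = 0 by rewrite /f /zext ltxx andbF.
have c0 : c_ 0%N = 0 by rewrite /c_ mul0r f0 normr0 ltW.
have c1 : c_ 1%N = 0.
  have h1 : 0%:R * h <= 1%:R * h <= 1%:R * h by rewrite mul0r mul1r lexx ltW.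
  have [+ _] := fclose 0%N (1%:R * h) isT h1.
  by rewrite mul0r f0 subr0 /c_ => ->.
have cN : c_ N = 0 by rewrite /c_ NT fT normr0 ltW.
have cN1 : c_ N.-1 = 0.
  have hN : N.-1%:R * h <= N.-1%:R * h <= N.-1.+1%:R * h.
    by rewrite lexx ler_wpM2r ?(ltW h0)// ler_nat.
  have [_ +] := fclose N.-1 (N.-1%:R * h) (leqnn _) hN.
  by rewrite NT fT subr0 /c_ => ->.
exists (step_sum h c_ N).
  apply: (@smooth_Ccinfty _ h (N.-1%:R * h)) => //; first exact: step_sum_smooth.
  - by rewrite -NT ltr_pM2r// ltr_nat.
  - move=> x xh; rewrite /step_sum big1// => -[[|i] iN] _ /=.
      by rewrite c0 c1 subrr mul0r.
    rewrite step_le0 ?mulr0// pmulr_lle0 ?invr_gt0// subr_le0 (le_trans xh)//.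
    by rewrite -{1}[h]mul1r ler_wpM2r ?(ltW h0)// ler1n.
  - move=> x hx; rewrite /step_sum big_ord_recr /= -/(step_sum _ _ _ _).
    by rewrite (step_sum_before _ h0 (leqnn _) hx) cN1 c0 cN !subrr mul0r addr0.
move=> x xT; have /andP[x0 xT'] := xT.
have xh0 : 0 <= x / h by rewrite divr_ge0 ?ltW.
pose j := Num.truncn (x / h).
have /andP[jx xj] := truncn_itv xh0; rewrite -/j in jx xj.
rewrite ler_pdivlMr// in jx; rewrite ltr_pdivrMr// in xj.
have jN : (j < N)%N.
  by rewrite -(ltr_nat R) -(ltr_pM2r h0) NT (le_lt_trans jx).
have xj' : j%:R * h <= x <= j.+1%:R * h by rewrite jx ltW.
rewrite (step_sum_on _ h0 jN xj') c0 subr0 -(zextE phi xT) -/f.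
have [a1 a2] := fclose j x jN xj'.
have b1 := c_close j; have b2 := c_close j.+1.
have /andP[s0 s1] := step_itv ((x - j%:R * h) / h).
move: (step _) s0 s1 => s s0 s1.
have A1 : `|f x - c_ j| <= e.
  by rewrite (le_trans (ler_distD (f (j%:R * h)) _ _))// [e]splitr lerD.
have A2 : `|f x - c_ j.+1| <= e.
  by rewrite (le_trans (ler_distD (f (j.+1%:R * h)) _ _))// [e]splitr lerD.
rewrite (_ : _ - _ = (1 - s) * (f x - c_ j) + s * (f x - c_ j.+1)); last by ring.
rewrite (le_trans (ler_normD _ _))// !normrM (ger0_norm s0) ger0_norm ?subr_ge0//.
have : (1 - s) * `|f x - c_ j| <= (1 - s) * e by rewrite ler_wpM2l ?subr_ge0.
have : s * `|f x - c_ j.+1| <= s * e by rewrite ler_wpM2l.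
lra.
Qed.

End Density.

Section Calculus.
Context {R : realType}.
Implicit Types (F f g : R -> R) (a b x h : R).
Local Notation mu := (@lebesgue_measure R).

Lemma is_derive_continuous F f : (forall x, is_derive x 1 F (f x)) -> continuous F.
Proof.
move=> Ff x; apply/differentiable_continuous/derivable1_diffP.
by have [] := Ff x.
Qed.

Lemma continuous_intg f a b : continuous f ->
  mu.-integrable `]a, b[%classic (EFin \o f).
Proof.
move=> cf; have : mu.-integrable `[a, b]%classic (EFin \o f).
  apply: continuous_compact_integrable; first exact: segment_compact.
  exact: continuous_subspaceT.
by apply: integrableS => //; exact: subset_itv_oo_cc.
Qed.

Lemma FTC_oo F f a b : a < b -> (forall x, is_derive x 1 F (f x)) ->
  continuous f -> \int[mu]_(x in `]a, b[) f x = F b - F a.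
Proof.
move=> ab Ff cf; have cF := is_derive_continuous Ff.
have i1 : mu.-integrable `[a, b]%classic (EFin \o f).
  apply: continuous_compact_integrable; first exact: segment_compact.
  exact: continuous_subspaceT.
have i2 := @continuous_intg f a b cf.
rewrite Rintegral_itv_obnd_cbnd// Rintegral_itv_bndo_bndc; last first.
  apply: integrableS i1 => //; exact: subset_itv_co_cc.
rewrite /Rintegral (@continuous_FTC2 _ f F)//.
- exact: continuous_subspaceT.
- split; first by move=> x _; have [] := Ff x.
  + by apply: cvg_at_right_filter; exact: cF.
  + by apply: cvg_at_left_filter; exact: cF.
- by move=> x _; rewrite derive1E; have [] := Ff x.
Qed.

Definition stepd : R -> R := derive1 (@step R).

Lemma is_derive_step x : is_derive x 1 (@step R) (stepd x).
Proof.
have [df sdf _] := @step_smooth R 1%N.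
by rewrite /stepd derive1E derive_val.
Qed.

Lemma smooth_derive f g : smooth f -> (forall x, is_derive x 1 f (g x)) -> smooth g.
Proof.
move=> sf fg n; have [df fdf dfn] := sf n.+1.
rewrite (_ : g = df)//; apply/funext => x.
by rewrite -(@derive_val _ _ _ _ _ _ _ (fdf x)) -(@derive_val _ _ _ _ _ _ _ (fg x)).
Qed.

Lemma stepd_smooth : smooth stepd.
Proof. exact: smooth_derive step_smooth is_derive_step. Qed.

Lemma smooth_continuous f : smooth f -> continuous f.
Proof. by move=> /(_ 1%N)[df fdf _]; exact: is_derive_continuous fdf. Qed.

Lemma stepd_lt0 x : x < 0 -> stepd x = 0.
Proof.
move=> x0; have h : is_derive x 1 (@step R) 0.
  apply: (@near_eq_is_derive R R R (cst 0) _ x 1 0 _ (is_derive_cst 0 x 1)).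
  by near=> y; rewrite step_le0//; apply: ltW; near: y; exact: lt_nbhsl.
by rewrite -(@derive_val _ _ _ _ _ _ _ h) -(@derive_val _ _ _ _ _ _ _ (is_derive_step x)).
Unshelve. all: by end_near. Qed.

Lemma stepd_gt1 x : 1 < x -> stepd x = 0.
Proof.
move=> x0; have h : is_derive x 1 (@step R) 0.
  apply: (@near_eq_is_derive R R R (cst (1 : R)) _ x 1 0 _ (is_derive_cst (1 : R) x 1)).
  by near=> y; rewrite step_ge1//; apply: ltW; near: y; exact: lt_nbhsr.
by rewrite -(@derive_val _ _ _ _ _ _ _ h) -(@derive_val _ _ _ _ _ _ _ (is_derive_step x)).
Unshelve. all: by end_near. Qed.

Lemma stepd_bounded : exists2 K, 0 < K & forall x, `|stepd x| <= K.
Proof.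
have [M hM] := continuous_bounded_segment 0 1 (smooth_continuous stepd_smooth).
exists (`|M| + 1) => [|x]; first by rewrite ltr_wpDl.
have [x0|x0] := ltP x 0; first by rewrite stepd_lt0// normr0 addr_ge0.
have [x1|x1] := ltP 1 x; first by rewrite stepd_gt1// normr0 addr_ge0.
rewrite (le_trans (hM x _)) ?x0 ?x1//.
by rewrite (le_trans (ler_norm M))// lerDl.
Qed.

Definition bump a h x : R := stepd ((x - a) / h) / h.

Lemma is_derive_bump a h x : is_derive x 1 (fun y => step ((y - a) / h)) (bump a h x).
Proof.
apply: (is_derive1_comp (f := @step R) (g := fun y : R => (y - a) / h)).
  exact: is_derive_step.
have /is_derive_eq : is_derive x 1 (fun y : R => (y - a) / h) (h^-1 *: (1 - 0)).
  rewrite (_ : (fun _ => _) = h^-1 *: (id - cst a)); last first.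
    by apply/funext => y; rewrite /= mulrC.
  by apply: is_deriveZ; exact: is_deriveB.
by apply; rewrite subr0 [_ *: _]mulr1.
Qed.

Lemma bump_smooth a h : smooth (bump a h).
Proof.
move=> n; apply: diff_nM; last exact: diff_n_cst.
rewrite (_ : (fun _ => _) = fun x => stepd (h^-1 * x + - (a / h))).
  exact/diff_n_affine/stepd_smooth.
by apply/funext => y; congr stepd; ring.
Qed.

Lemma bump_out a h x : 0 < h -> x < a \/ a + h < x -> bump a h x = 0.
Proof.
move=> h0 [xa|ax]; rewrite /bump.
  by rewrite stepd_lt0 ?mul0r// pmulr_llt0 ?invr_gt0// subr_lt0.
by rewrite stepd_gt1 ?mul0r// ltr_pdivlMr// mul1r ltrBrDl.
Qed.

Variable T : R.
Hypothesis T_gt0 : 0 < T.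
Local Notation D := (`]0, T[%classic : set R).

Lemma bump_Ccinfty a h : 0 < a -> 0 < h -> a + h < T -> Ccinfty T (bump a h).
Proof.
move=> a0 h0 ahT; apply: (@smooth_Ccinfty _ T _ (a / 2) ((a + h + T) / 2)).
- exact: bump_smooth.
- by lra.
- by lra.
- by move=> x xa; apply: bump_out => //; left; lra.
- by move=> x xa; apply: bump_out => //; right; lra.
Qed.

Lemma Rintegral_bump a h : 0 < a -> 0 < h -> a + h < T ->
  \int[mu]_(x in D) bump a h x = 1.
Proof.
move=> a0 h0 ahT; rewrite (FTC_oo T_gt0 (is_derive_bump a h)).
  rewrite step_ge1 ?step_le0 ?subr0//.
    by rewrite pmulr_lle0 ?invr_gt0//; lra.
  by rewrite ler_pdivlMr//; lra.
exact/smooth_continuous/bump_smooth.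
Qed.

End Calculus.

Section Measures.
Context {R : realType}.
Variable T : R.
Hypothesis T_gt0 : 0 < T.
Implicit Types (u v w g h phi psi : R -> R) (x y e a b c : R).
Implicit Types (m : (R -> R) -> R).

Local Notation mu := (@lebesgue_measure R).
Local Notation D := (`]0, T[%classic : set R).
Local Notation intg u := (mu.-integrable D (EFin \o u)).

Lemma L1_triangle u v w : intg u -> intg v -> intg w ->
  \int[mu]_(x in D) `|u x - w x| <=
  \int[mu]_(x in D) `|u x - v x| + \int[mu]_(x in D) `|v x - w x|.
Proof.
move=> ui vi wi; rewrite -RintegralD//; try exact/intg_norm/intgB.
apply: le_Rintegral => //; [exact/intg_norm/intgB|apply: intgD => //; exact/intg_norm/intgB|].
by move=> x _; exact: ler_distD.
Qed.

Lemma Rintegral_norm_le u b : intg u -> (forall x, 0 < x < T -> `|u x| <= b) ->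
  \int[mu]_(x in D) `|u x| <= b * T.
Proof.
move=> ui ub; have -> : b * T = \int[mu]_(x in D) b.
  by rewrite Rintegral_cst//= lebesgue_measure_itv/= lte_fin T_gt0 oppr0 addr0.
apply: le_Rintegral => //; first exact: intg_norm.
by apply: (@intg_bounded _ _ _ _ _ _ _ `|b|) => //; exact: muD_finite.
Qed.

Lemma continuous_dense_L1 g e : intg g -> 0 < e ->
  exists2 g1, continuous g1 & \int[mu]_(x in D) `|g x - g1 x| <= e.
Proof.
move=> gi e0.
have [g_ [cg ig lim]] := approximation_continuous_integrable (measurable_itv _) (muD_finite T) gi.
have /lim : nbhs (0 : \bar R)%E [set y | (y < e%:E)%E].
  by apply: open_nbhs_nbhs; split; [exact: open_ereal_lt_ereal|rewrite /= lte_fin].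
case=> n _ /(_ n (leqnn n)) /= h; exists (g_ n) => //.
rewrite -lee_fin /Rintegral fineK ?ltW// ge0_fin_numE ?(lt_trans h) ?ltry//.
by apply: integral_ge0 => x _; rewrite lee_fin.
Qed.

Lemma C0_dense_L1 g e : intg g -> 0 < e ->
  exists2 g1, C0 T g1 & \int[mu]_(x in D) `|g x - g1 x| <= e.
Proof.
move=> gi e0; have e20 : 0 < e / 2 by rewrite divr_gt0.
have [g1 cg1 gg1] := continuous_dense_L1 gi e20.
have [M0 hM0] := continuous_bounded_segment 0 T cg1.
pose M := `|M0| + 1; have M_gt0 : 0 < M by rewrite ltr_wpDl.
have hM x : 0 < x < T -> `|g1 x| <= M.
  move=> /andP[x0 xT]; have /hM0/le_trans : 0 <= x <= T by rewrite !ltW.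
  by apply; rewrite (le_trans (ler_norm _))// lerDl.
pose h := e / 2 / (2 * M); have h0 : 0 < h by rewrite divr_gt0// mulr_gt0.
pose chi x := step (x / h) * step ((T - x) / h).
have cchi : continuous chi.
  have cs := smooth_continuous (@step_smooth R).
  move=> x; apply: (@continuousM _ R (fun x => step (x / h)) (fun x => step ((T - x) / h))).
    apply: (@continuous_comp _ _ _ (fun x => x / h) (@step R)); last exact: cs.
    exact: mulrr_continuous.
  apply: (@continuous_comp _ _ _ (fun x => (T - x) / h) (@step R)); last exact: cs.
  apply: (@continuousM _ R (fun x => T - x) (fun=> h^-1)); last exact: cst_continuous.
  by apply: continuousB; [exact: cst_continuous|exact: cvg_id].
have chi01 x : 0 <= chi x <= 1.
  have /andP[a1 a2] := step_itv (x / h); have /andP[b1 b2] := step_itv ((T - x) / h).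
  by rewrite /chi mulr_ge0//= mulr_ile1.
exists (fun x => g1 x * chi x).
  apply: C0_of_continuous.
  - by move=> x; apply: (@continuousM _ R g1 chi); [exact: cg1|exact: cchi].
  - by rewrite /chi mul0r step_le0// mul0r mulr0.
  - by rewrite /chi subrr mul0r (step_le0 (lexx 0)) !mulr0.
have g1i : intg g1 by exact: continuous_intg.
have g1ci : intg (fun x => g1 x * chi x).
  apply: (@intgM _ _ _ _ _ _ _ _ 1) => //.
    by apply: measurable_funTS; exact: continuous_measurable_fun.
  by move=> x _; have /andP[? ?] := chi01 x; rewrite ger0_norm.
apply: (le_trans (L1_triangle gi g1i g1ci)); rewrite [e]splitr lerD//.
pose A := `]0, h[%classic : set R; pose B := `](T - h), T[%classic : set R.
have ind_i (C : set R) : measurable C -> intg (fun x => \1_C x).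
  move=> mC; apply: (@intg_bounded _ _ _ _ _ _ _ 1) .
  - by [].
  - exact: muD_finite.
  - by apply: measurable_funTS; exact: measurable_indic.
  by move=> x _; rewrite indicE; case: (_ \in _); rewrite ?normr1 ?normr0.
have ind_le p q : p <= q -> \int[mu]_(x in D) \1_(`]p, q[%classic : set R) x <= q - p.
  move=> pq; rewrite /Rintegral integral_indic//.
  rewrite -lee_fin fineK; last first.
    rewrite ge0_fin_numE// (le_lt_trans _ (muD_finite T))//.
    by apply: le_measure; rewrite ?inE//; exact: measurableI.
  apply: (@le_trans _ _ (mu `]p, q[%classic)).
    by apply: le_measure; rewrite ?inE//; exact: measurableI.
  rewrite /= lebesgue_measure_itv/= lte_fin; case: ifPn => _; first by rewrite EFinB.
  by rewrite lee_fin subr_ge0.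
apply: (@le_trans _ _ (\int[mu]_(x in D) (M * (\1_A x + \1_B x)))).
  apply: le_Rintegral; first by [].
  - by apply: intg_norm => //; exact: (intgB _ g1i g1ci).
  - by apply: intgZ => //; apply: intgD => //; apply: ind_i; exact: measurable_itv.
  move=> x /=; rewrite in_itv/= => xD; have /andP[x0 xT] := xD.
  rewrite -[X in `|X - _|]mulr1 -mulrBr normrM; have /andP[c0 c1] := chi01 x.
  rewrite ler_pM//; first exact: hM.
  rewrite ger0_norm ?subr_ge0// !indicE.
  have [xA|xA] := boolP (x \in A); first by rewrite lerBlDr -addrA lerDl addr_ge0.
  have [xB|xB] := boolP (x \in B); first by rewrite lerBlDr add0r lerDl.
  have hx : h <= x.
    by rewrite leNgt; apply: contra xA => xh; rewrite inE /A/= in_itv/= x0.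
  have xh : x <= T - h.
    by rewrite leNgt; apply: contra xB => xh; rewrite inE /B/= in_itv/= xT andbT.
  by rewrite /chi !step_ge1 ?mulr1 ?subrr ?addr0// ler_pdivlMr// mul1r// lerBrDr -lerBrDl.
rewrite RintegralZl//; last by apply: intgD => //; apply: ind_i; exact: measurable_itv.
rewrite RintegralD//; [|apply: ind_i; exact: measurable_itv|apply: ind_i; exact: measurable_itv].
apply: (@le_trans _ _ (M * (h + h))).
  rewrite ler_wpM2l ?(ltW M_gt0)// lerD//.
    by rewrite (le_trans (ind_le 0 h _)) ?subr0// ltW.
  by rewrite (le_trans (ind_le (T - h) T _)) ?opprB ?subrKC// gerBl ltW.
by rewrite /h le_eqVlt; apply/orP; left; apply/eqP; field; rewrite gt_eqF.
Qed.

Lemma Ccinfty_intg phi : Ccinfty T phi -> intg phi.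
Proof. by move=> /Ccinfty_continuous; exact: continuous_intg. Qed.

Lemma C0_intg phi : C0 T phi -> intg phi.
Proof.
move=> c; apply: (@intg_bounded _ _ _ _ _ _ _ (normC T phi)) => //.
- exact: muD_finite.
- exact: C0_measurable.
- exact: C0_bound.
Qed.

Lemma Ccinfty_dense_L1 g e : intg g -> 0 < e ->
  exists2 psi, Ccinfty T psi & \int[mu]_(x in D) `|g x - psi x| <= e.
Proof.
move=> gi e0; have e20 : 0 < e / 2 by rewrite divr_gt0.
have [g1 cg1 gg1] := C0_dense_L1 gi e20.
have [psi cpsi hpsi] := Ccinfty_dense T_gt0 cg1 (divr_gt0 e20 T_gt0).
exists psi => //; have g1i := C0_intg cg1; have pi := Ccinfty_intg cpsi.
apply: (le_trans (L1_triangle gi g1i pi)); rewrite [e]splitr lerD//.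
rewrite (le_trans (Rintegral_norm_le _ hpsi)) ?divfK ?gt_eqF//; exact: intgB.
Qed.

End Measures.

(** * Measures and distributional derivatives *)

Section DualSpace.
Context {R : realType}.
Variable T : R.
Hypothesis T_gt0 : 0 < T.
Implicit Types (u v w g h phi psi : R -> R) (x y e a b c : R).
Implicit Types (m n : (R -> R) -> R).

Local Notation mu := (@lebesgue_measure R).
Local Notation D := (`]0, T[%classic : set R).
Local Notation intg u := (mu.-integrable D (EFin \o u)).

Lemma M_lin m a phi psi : Mspace T m -> C0 T phi -> C0 T psi ->
  m (a *: phi + psi) = a * m phi + m psi.
Proof. by move=> [l _]; exact: l. Qed.

Lemma M_0 m : Mspace T m -> m 0 = 0.
Proof.
move=> mM; have := M_lin 1 mM (C0_0 T) (C0_0 T).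
by rewrite scaler0 addr0 mul1r => /eqP; rewrite -subr_eq0 opprD addNKr oppr_eq0 => /eqP.
Qed.

Lemma M_scale m a phi : Mspace T m -> C0 T phi -> m (a *: phi) = a * m phi.
Proof.
by move=> mM cp; have := M_lin a mM cp (C0_0 T); rewrite !addr0 M_0 ?addr0.
Qed.

Lemma M_sub m phi psi : Mspace T m -> C0 T phi -> C0 T psi ->
  m (phi - psi) = m phi - m psi.
Proof.
move=> mM cp cq; rewrite addrC -scaleN1r M_lin// mulN1r addrC //.
Qed.

Lemma M_bound m : Mspace T m ->
  exists2 B, 0 <= B & forall phi, C0 T phi -> `|m phi| <= B * normC T phi.
Proof.
move=> [_ [B hB]]; exists `|B| => // phi c; rewrite (le_trans (hB phi c))//.
by rewrite ler_wpM2r ?normC_ge0// ler_norm.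
Qed.

Lemma normM_has_ubound m : Mspace T m ->
  has_ubound [set `|m phi| | phi in C0 T `&` [set phi | normC T phi <= 1]].
Proof.
move=> /M_bound[B B0 hB]; exists B => _ [phi [c c1] <-].
by rewrite (le_trans (hB phi c))// ler_piMr.
Qed.

Lemma normM_ge m phi : Mspace T m -> C0 T phi ->
  `|m phi| <= normM T m * normC T phi.
Proof.
move=> mM cp; have [p0|p0] := eqVneq (normC T phi) 0.
  by have [B B0 /(_ _ cp)] := M_bound mM; rewrite p0 !mulr0.
have pp : 0 < normC T phi by rewrite lt_def p0 normC_ge0.
rewrite -ler_pdivrMr//.
have -> : `|m phi| / normC T phi = `|m ((normC T phi)^-1 *: phi)|.
  by rewrite M_scale// normrM normfV (gtr0_norm pp) mulrC.
apply: ub_le_sup; first exact: normM_has_ubound.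
exists ((normC T phi)^-1 *: phi) => //; split; first exact: C0_scale.
by rewrite /= (le_trans (normCZ_le _ _ _))// normfV (gtr0_norm pp) mulVf.
Qed.

Lemma normM_le m b : (forall phi, C0 T phi -> `|m phi| <= b * normC T phi) ->
  0 <= b -> normM T m <= b.
Proof.
move=> hb b0; apply: ge_sup.
  exists `|m 0|, 0 => //; split; first exact: C0_0.
  by apply: normC_le => // x _; rewrite normr0.
by move=> _ [phi [cp c1] <-]; rewrite (le_trans (hb phi cp))// ler_piMr.
Qed.

Lemma normM_ge0 m : Mspace T m -> 0 <= normM T m.
Proof.
move=> mM; apply: (le_trans (normr_ge0 (m 0))); apply: ub_le_sup.
  exact: normM_has_ubound.
exists 0 => //; split; first exact: C0_0.
by apply: normC_le => // x _; rewrite normr0.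
Qed.

Lemma Mspace_lin a m n : Mspace T m -> Mspace T n -> Mspace T (fun phi => a * m phi + n phi).
Proof.
move=> mM nM; split.
  by move=> b phi psi cp cq; rewrite !M_lin//; ring.
have [B B0 hB] := M_bound mM; have [B' B'0 hB'] := M_bound nM.
exists (`|a| * B + B') => phi c; rewrite (le_trans (ler_normD _ _))// mulrDl lerD ?hB'//.
by rewrite normrM -mulrA ler_wpM2l// hB.
Qed.

Lemma Mspace_0 : Mspace T (fun=> 0).
Proof.
split; first by move=> *; rewrite mulr0 addr0.
by exists 0 => phi c; rewrite normr0 mul0r.
Qed.

Lemma Mspace_sub m n : Mspace T m -> Mspace T n -> Mspace T (m - n).
Proof.
move=> mM nM; rewrite (_ : m - n = fun phi => -1 * n phi + m phi).
  exact: Mspace_lin.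
by apply/funext => phi; rewrite mulN1r addrC.
Qed.

Lemma M_eq m n : Mspace T m -> Mspace T n ->
  (forall phi, Ccinfty T phi -> m phi = n phi) ->
  forall phi, C0 T phi -> m phi = n phi.
Proof.
move=> mM nM mn phi cp; apply/eqP; rewrite -subr_eq0 -normr_le0; apply/ler_addgt0Pl => e e0.
rewrite addr0; have [B B0 hB] := M_bound (Mspace_sub mM nM).
have B1 : 0 < B + 1 by rewrite ltr_wpDl.
have [psi cpsi hpsi] := Ccinfty_dense T_gt0 cp (divr_gt0 e0 B1).
have cq := Ccinfty_C0 cpsi.
have -> : m phi - n phi = (m - n) (phi - psi).
  have E chi : (m - n) chi = m chi - n chi by [].
  by rewrite M_sub//; [rewrite !E (mn psi cpsi) subrr subr0|exact: Mspace_sub].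
rewrite (le_trans (hB _ (C0_sub cp cq)))//.
apply: (@le_trans _ _ (B * (e / (B + 1)))).
  by rewrite ler_wpM2l// normC_le.
rewrite mulrA ler_pdivrMr// mulrC ler_pM2l// lerDl//.
Qed.

Lemma densityE w phi : density T w phi = \int[mu]_(x in D) (w x * phi x).
Proof. exact: dotL2E. Qed.

Lemma intg_mulC0 w phi : intg w -> C0 T phi -> intg (fun x => w x * phi x).
Proof.
move=> wi c; apply: (@intgM _ _ _ _ _ _ _ _ (normC T phi)) => //.
- exact: C0_measurable.
- exact: C0_bound.
Qed.

Lemma density_Mspace w : intg w -> Mspace T (density T w).
Proof.
move=> wi; split.
  by move=> a phi psi cp cq; apply: dotL2_linr; exact: intg_mulC0.
exists (\int[mu]_(x in D) `|w x|) => phi c; rewrite densityE.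
apply: normr_RintegralM_le => //; [exact: C0_measurable|exact: C0_bound].
Qed.

Lemma density_lin a v w phi : intg v -> intg w -> C0 T phi ->
  density T (a *: v + w) phi = a * density T v phi + density T w phi.
Proof. by move=> vi wi c; apply: dotL2_linl; exact: intg_mulC0. Qed.

Lemma BVderivP u : BV T u -> distributional_derivative T u (BVderiv T u).
Proof. by move=> [_ [m um]]; rewrite /BVderiv; exact: (xgetPex (fun=> 0) (P := [set m | distributional_derivative T u m]) (ex_intro _ m um)). Qed.

Lemma BVderivE u m phi : distributional_derivative T u m -> C0 T phi ->
  BVderiv T u phi = m phi.
Proof.
move=> um; have [bM bE] : distributional_derivative T u (BVderiv T u).
  exact: (xgetPex (fun=> 0) (P := [set m | distributional_derivative T u m]) (ex_intro _ m um)).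
have [mM mE] := um; apply: M_eq => // psi cpsi.
by rewrite bE// mE.
Qed.

Lemma Ccinfty_derive phi : Ccinfty T phi -> Ccinfty T (derive1 phi).
Proof.
move=> cphi; have [dphi [a [b [a0 bT h]]]] := cphi; split.
  by move=> n x; rewrite -derive1Sn; exact: dphi.
exists a, b; split => // x; apply: contraNT => xab.
rewrite derive1E; apply/eqP; have : is_derive x 1 phi 0; last by move=> [].
apply: (@near_eq_is_derive R R R (cst 0) _ x 1 0 _ (is_derive_cst 0 x 1)).
move: xab; rewrite negb_and -!ltNge => /orP[xa|bx]; near=> y.
  apply/esym/eqP; apply: contraT => /h/andP[ay _].
  suff : y < a by rewrite ltNge ay.
  by near: y; exact: lt_nbhsl.
apply/esym/eqP; apply: contraT => /h/andP[_ yb].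
suff : b < y by rewrite ltNge yb.
by near: y; exact: lt_nbhsr.
Unshelve. all: by end_near. Qed.

Lemma Ccinfty_is_derive phi x : Ccinfty T phi -> is_derive x 1 phi (derive1 phi x).
Proof.
by move=> [/(_ 0%N x) d _]; apply: DeriveDef => //; rewrite derive1E.
Qed.

Lemma distributional_derivative_lin a u v m n : intg u -> intg v ->
  distributional_derivative T u m -> distributional_derivative T v n ->
  distributional_derivative T (a *: u + v) (fun phi => a * m phi + n phi).
Proof.
move=> ui vi [mM mE] [nM nE]; split; first exact: Mspace_lin.
move=> phi cphi; rewrite mE// nE//.
have c' := Ccinfty_C0 (Ccinfty_derive cphi).
by rewrite dotL2_linl; [ring|exact: intg_mulC0|exact: intg_mulC0].
Qed.

End DualSpace.

Lemma dist_le_close {R : realFieldType} (a b c d e B : R) :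
  `|a - c| <= e / 2 -> `|b - d| <= e / 2 -> `|a - b| <= B -> `|c - d| <= e + B.
Proof.
rewrite !ler_norml => /andP[? ?] /andP[? ?] /andP[? ?].
by apply/andP; split; lra.
Qed.

Section EssentiallyBounded.
Context {R : realType}.
Variable T : R.
Hypothesis T_gt0 : 0 < T.
Implicit Types (f u v w g phi psi : R -> R) (x y e a b c h M : R).
Implicit Types (m n : (R -> R) -> R).

Local Notation mu := (@lebesgue_measure R).
Local Notation D := (`]0, T[%classic : set R).
Local Notation intg u := (mu.-integrable D (EFin \o u)).

Definition ess_bounded u M := {ae mu, forall x, D x -> `|u x| <= M}.

Lemma ess_bounded_L2 u M : measurable_fun setT u -> ess_bounded u M -> L2 T u.
Proof.
move=> mu_ [A [mA A0 hA]]; apply: (@L2_bounded _ T u M) => //.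
exists (A `|` ~` D); split.
- by apply: measurableU => //; exact: measurableC.
- apply/eqP; rewrite -measure_le0 /muT /= /mrestr setIUl setICl setU0 -A0.
  by apply: le_measure; rewrite ?inE//; exact: measurableI.
- move=> x /= nx; have [Dx|Dx] := pselect (D x); last by right.
  by left; apply: hA => /= /(_ Dx).
Qed.

Lemma intgM_ess f g M : 0 <= M -> intg f -> measurable_fun D g -> ess_bounded g M ->
  intg (fun x => f x * g x) /\
  `|\int[mu]_(x in D) (f x * g x)| <= (\int[mu]_(x in D) `|f x|) * M.
Proof.
move=> M0 fi mg gM; have mf := intg_measurable fi.
have nfi := intg_norm fi.
have nfMi : intg (fun x => M * `|f x|) by exact: intgZ.
have mfg : measurable_fun D (fun x => f x * g x) by exact: measurable_funM.
have le1 : (\int[mu]_(x in D) (`|f x * g x|)%:E <= \int[mu]_(x in D) (M * `|f x|)%:E)%E.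
  apply: ae_ge0_le_integral => //.
  - by apply/measurable_EFinP; exact: measurableT_comp.
  - by move=> x _; rewrite lee_fin mulr_ge0.
  - exact: (measurable_int _ nfMi).
  - apply: (@filterS _ _ (ae_filter_ringOfSetsType mu)) gM => x /= gxM Dx.
    by rewrite lee_fin normrM mulrC ler_wpM2r// gxM.
have fgi : intg (fun x => f x * g x).
  apply/integrableP; split; first exact/measurable_EFinP.
  apply: (le_lt_trans le1); have /integrableP[_] := nfMi.
  apply: le_lt_trans; apply: ge0_le_integral => //.
  - by move=> x _; rewrite lee_fin mulr_ge0.
  - exact: (measurable_int _ nfMi).
  - by apply: measurableT_comp => //; exact: (measurable_int _ nfMi).
  - by move=> x _ /=; rewrite lee_fin ler_norm.
split=> //; apply: (le_trans (le_normr_Rintegral _ fgi)) => //.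
have nfgi := intg_norm fgi.
rewrite mulrC -RintegralZl// -lee_fin /Rintegral !fineK//.
- exact: integrable_fin_num nfMi.
- exact: integrable_fin_num nfgi.
Qed.

Lemma lebesgue_pt_ball u x e : intg u -> lebesgue_pt (u \_ D) x -> D x -> 0 < e ->
  exists2 d, 0 < d & forall r, 0 < r < d ->
  (\int[mu]_(y in ball x r) `|(u y - u x)%:E| <= (e * r)%:E)%E.
Proof.
move=> ui lx Dx e0; have e20 : 0 < e / 2 by rewrite divr_gt0.
have xT : 0 < x < T by move: Dx; rewrite /= in_itv.
have /lx : nbhs (0 : \bar R)%E [set y | (y < (e / 2)%:E)%E].
  by apply: open_nbhs_nbhs; split; [exact: open_ereal_lt_ereal|rewrite /= lte_fin].
case=> d0 /= d00 hd; pose d := Num.min d0 (Num.min x (T - x)).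
exists d; first by rewrite !lt_min d00/= subr_gt0.
move=> r /andP[r0]; rewrite !lt_min => /and3P[rd0 rx rT].
have := hd r; rewrite /= sub0r normrN gtr0_norm// => /(_ rd0 r0).
rewrite /davg /iavg lebesgue_measure_ball ?(ltW r0)//.
rewrite inver (_ : r *+ 2 == 0 = false); last by rewrite mulrn_eq0/= gt_eqF.
have ballD y : ball x r y -> D y.
  by rewrite ball_itv/= !in_itv/= => /andP[y1 y2]; apply/andP; split; lra.
rewrite (_ : (\int[mu]_(y in ball x r) _)%E = (\int[mu]_(y in ball x r) `|(u y - u x)%:E|)%E); last first.
  apply: eq_integral => y /[!inE] yb.
  by rewrite /= !patchE !mem_set//; exact: ballD.
rewrite lte_pdivrMl ?pmulrn_lgt0// => /ltW; congr (_ <= _)%E.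
by rewrite -EFinM; congr EFin; field.
Qed.

Lemma lebesgue_pt_bump u x e : intg u -> lebesgue_pt (u \_ D) x -> D x -> 0 < e ->
  exists2 d, 0 < d & forall h, 0 < h < d ->
  `|\int[mu]_(y in D) (u y * bump x h y) - u x| <= e.
Proof.
move=> ui lx Dx e0; have xT : 0 < x < T by move: Dx; rewrite /= in_itv.
have [K K0 hK] := @stepd_bounded R.
have eK : 0 < e / (2 * K) by rewrite divr_gt0// mulr_gt0.
have [d0 d00 hd] := lebesgue_pt_ball ui lx Dx eK.
pose d := Num.min d0 (Num.min x (T - x)).
have /andP[x0 xT'] := xT.
exists (d / 2); first by rewrite divr_gt0// !lt_min d00/= x0 subr_gt0.
move=> h /andP[h0 hd2].
have : 2 * h < d by rewrite mulrC -ltr_pdivlMr.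
rewrite !lt_min => /and3P[hd0 hx hT].
have h20 : 0 < 2 * h by rewrite mulr_gt0.
have := hd (2 * h); rewrite h20 hd0 => /(_ isT) lh.
have bC : Ccinfty T (bump x h) by apply: bump_Ccinfty => //; lra.
have ub : intg (fun y => u y * bump x h y) by apply: intg_mulC0 => //; exact: Ccinfty_C0.
have bi := Ccinfty_intg bC.
have ubi : intg (fun y => u x * bump x h y) by exact: intgZ.
have -> : \int[mu]_(y in D) (u y * bump x h y) - u x =
    \int[mu]_(y in D) ((u y - u x) * bump x h y).
  rewrite -[X in _ - X]mulr1 -(@Rintegral_bump _ T T_gt0 x h) //; last lra.
  rewrite -RintegralZl// -RintegralB//.
  by apply: eq_Rintegral => y _; rewrite mulrBl.
have uxbi : intg (fun y => (u y - u x) * bump x h y).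
  by apply: eq_intg (intgB _ ub ubi) => // y _; rewrite mulrBl.
apply: (le_trans (le_normr_Rintegral _ uxbi)) => //.
have nuxbi := intg_norm uxbi.
rewrite -lee_fin /Rintegral fineK; last exact: integrable_fin_num nuxbi.
have ballD y : ball x (2 * h) y -> D y.
  by rewrite ball_itv/= !in_itv/= => /andP[y1 y2]; apply/andP; split; lra.
have bout y : ~ ball x (2 * h) y -> bump x h y = 0.
  rewrite ball_itv/= in_itv/= => /negP; rewrite negb_and -!leNgt => /orP[yx|yx].
    by apply: bump_out => //; left; lra.
  by apply: bump_out => //; right; lra.
rewrite integral_mkcond (_ : _ \_ D = (fun y => (`|(u y - u x) * bump x h y|)%:E) \_ (ball x (2 * h))); last first.
  apply/funext => y; rewrite !patchE; case: ifPn => yD; case: ifPn => yB //.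
    rewrite bout ?mulr0 ?normr0//.
    by move: yB => /negP yB yb; apply: yB; rewrite inE.
  by move: yD yB => /negP yD; rewrite inE => /ballD yB; exfalso; apply: yD; rewrite inE.
rewrite -integral_mkcond.
have mB : measurable (ball x (2 * h)) by exact: measurable_ball.
have sBD : ball x (2 * h) `<=` D by move=> y; exact: ballD.
have umB : measurable_fun (ball x (2 * h)) (fun y => `|u y - u x|).
  apply: measurableT_comp => //; apply: measurable_funB => //.
  by apply: measurable_funS sBD (intg_measurable ui).
apply: (@le_trans _ _ (\int[mu]_(y in ball x (2 * h)) ((K / h)%:E * (`|(u y - u x)|)%:E))%E).
  apply: ge0_le_integral => //.
  - apply/measurable_EFinP; apply: measurable_funS sBD _ => //.
    exact: intg_measurable nuxbi.
  - by apply: measurable_funeM; exact/measurable_EFinP.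
  - move=> y _; rewrite -EFinM lee_fin normrM mulrC ler_wpM2r//.
    by rewrite /bump normrM normfV (gtr0_norm h0) ler_wpM2r ?invr_ge0 ?(ltW h0).
rewrite ge0_integralZl//; last 2 first.
- exact/measurable_EFinP.
- by rewrite lee_fin divr_ge0 ?ltW.
apply: (@le_trans _ _ ((K / h)%:E * (e / (2 * K) * (2 * h))%:E)%E).
  by rewrite lee_pmul2l// lte_fin divr_gt0.
rewrite -EFinM lee_fin le_eqVlt; apply/orP; left; apply/eqP; field.
by rewrite !gt_eqF.
Qed.

(* Tested with a smooth approximation of the indicator function of (x,y). *)
Lemma BV_oscillation u m B x y : intg u -> distributional_derivative T u m ->
  (forall phi, C0 T phi -> `|m phi| <= B * normC T phi) -> 0 <= B ->
  lebesgue_pt (u \_ D) x -> lebesgue_pt (u \_ D) y -> 0 < x -> x < y -> y < T ->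
  `|u x - u y| <= B.
Proof.
move=> ui [mM mE] hB B0 lx ly x0 xy yT; apply/ler_addgt0Pl => e e0.
have e20 : 0 < e / 2 by rewrite divr_gt0.
have [|d1 d10 h1] := lebesgue_pt_bump ui lx _ e20.
  by rewrite /= in_itv/= x0 (lt_trans xy).
have [|d2 d20 h2] := lebesgue_pt_bump ui ly _ e20.
  by rewrite /= in_itv/= yT (lt_trans x0).
pose d := Num.min (Num.min d1 d2) (Num.min (y - x) (T - y)).
have d0 : 0 < d by rewrite !lt_min d10 d20 !subr_gt0 xy yT.
pose h := d / 2; have h0 : 0 < h by rewrite divr_gt0.
have : h < d by rewrite ltr_pdivrMr// ltr_pMr// ltr1n.
rewrite !lt_min => /andP[/andP[hd1 hd2] /andP[hyx hTy]].
have := h1 h; rewrite h0 hd1 => /(_ isT) k1.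
have := h2 h; rewrite h0 hd2 => /(_ isT) k2.
pose phi z := step ((z - x) / h) - step ((z - y) / h).
have dphi (z : R) : is_derive z 1 phi (bump x h z - bump y h z).
  by apply: is_deriveB; exact: is_derive_bump.
have sphi : smooth phi.
  move=> n; have sm a : diff_n n (fun z : R => step ((z - a) / h)).
    rewrite (_ : (fun _ => _) = fun z => step (h^-1 * z + - (a / h))).
      exact/diff_n_affine/step_smooth.
    by apply/funext => z; congr step; ring.
  rewrite (_ : phi = fun z => step ((z - x) / h) + (-1) * step ((z - y) / h)).
    by apply: diff_nD => //; apply: diff_nM => //; exact: diff_n_cst.
  by apply/funext => z; rewrite mulN1r.
have cphi : Ccinfty T phi.
  apply: (@smooth_Ccinfty _ T _ x (y + h)) => //; first by lra.
    move=> z zx; rewrite /phi !step_le0 ?subrr// pmulr_lle0 ?invr_gt0//; lra.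
  move=> z zx; rewrite /phi !step_ge1 ?subrr// ler_pdivlMr//; lra.
have phi1 : normC T phi <= 1.
  apply: normC_le => // z _; rewrite /phi.
  have /andP[a0 a1] := step_itv ((z - x) / h).
  have /andP[b0 b1] := step_itv ((z - y) / h).
  by rewrite ler_norml; apply/andP; split; lra.
have bxC : Ccinfty T (bump x h) by apply: bump_Ccinfty => //; lra.
have byC : Ccinfty T (bump y h) by apply: bump_Ccinfty => //; lra.
have k3 : `|\int[mu]_(z in D) (u z * bump x h z) - \int[mu]_(z in D) (u z * bump y h z)| <= B.
  rewrite -RintegralB//; [|exact/intg_mulC0/Ccinfty_C0|exact/intg_mulC0/Ccinfty_C0].
  have -> : \int[mu]_(z in D) (u z * bump x h z - u z * bump y h z) = - m phi.
    rewrite mE// opprK dotL2E; apply: eq_Rintegral => z _.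
    by rewrite -mulrBr derive1E (@derive_val _ _ _ _ _ _ _ (dphi z)).
  rewrite normrN (le_trans (hB _ (Ccinfty_C0 cphi)))//.
  by rewrite -[leRHS]mulr1 ler_wpM2l.
exact: dist_le_close k1 k2 k3.
Qed.

Lemma BV_ess_bounded u m : intg u -> distributional_derivative T u m ->
  exists2 M, 0 <= M & ess_bounded u M.
Proof.
move=> ui um; have [mM _] := um; have [B B0 hB] := M_bound T_gt0 mM.
have ae_pt := lebesgue_differentiation (integrable_locally_restrict (measurable_itv _) ui).
have [[x0 [Dx0 lx0]]|none] := pselect (exists x, D x /\ lebesgue_pt (u \_ D) x); last first.
  exists 0 => //; apply: (@filterS _ _ (ae_filter_ringOfSetsType mu)) ae_pt => x lx Dx.
  by exfalso; apply: none; exists x.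
exists (`|u x0| + B); first by rewrite addr_ge0.
apply: (@filterS _ _ (ae_filter_ringOfSetsType mu)) ae_pt => x lx Dx.
move: Dx Dx0; rewrite /= !in_itv/= => /andP[x_gt0 xT] /andP[x0_gt0 x0T].
have : `|u x - u x0| <= B.
  have [xx0|xx0|->] := ltgtP x x0; last by rewrite subrr normr0.
    exact: BV_oscillation um hB B0 lx lx0 _ _ _.
  by rewrite distrC; exact: BV_oscillation um hB B0 lx0 lx _ _ _.
move=> h; rewrite -[u x](subrK (u x0)) addrC (le_trans (ler_normD _ _))// lerD2l//.
Qed.

End EssentiallyBounded.

Section Primitive.
Context {R : realType}.
Variable T : R.
Hypothesis T_gt0 : 0 < T.
Implicit Types (f u v w g phi psi : R -> R) (x y e a b c h M : R).
Implicit Types (m n : (R -> R) -> R).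

Local Notation mu := (@lebesgue_measure R).
Local Notation D := (`]0, T[%classic : set R).
Local Notation intg u := (mu.-integrable D (EFin \o u)).

Lemma C0_eq phi psi : (forall x, 0 < x < T -> phi x = psi x) -> C0 T phi -> C0 T psi.
Proof.
move=> pq [c l r]; split.
- move=> x xD; rewrite /continuous_at -(pq x); last by move: xD; rewrite in_itv.
  apply: cvg_trans (c x xD); apply: near_eq_cvg.
  move: xD; rewrite in_itv/= => /andP[x0 xT].
  near=> y; rewrite pq//; apply/andP; split.
    by near: y; exact: lt_nbhsr.
  by near: y; exact: lt_nbhsl.
- apply: cvg_trans l; apply: near_eq_cvg; near=> y; rewrite pq//.
  apply/andP; split; first by near: y; exact: nbhs_right_gt.
  by near: y; exact: nbhs_right_lt.
- apply: cvg_trans r; apply: near_eq_cvg; near=> y; rewrite pq//.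
  apply/andP; split; first by near: y; exact: nbhs_left_gt.
  by near: y; exact: nbhs_left_lt.
Unshelve. all: by end_near. Qed.

Lemma primitiveE g x : intg g -> 0 < x < T ->
  primitive g x = \int[mu]_(s in D) (g s * \1_(`]0, x]%classic : set R) s).
Proof.
move=> gi /andP[x0 xT]; rewrite /primitive -Rintegral_itv_obnd_cbnd.
  have -> : (`]0, x]%classic : set R) = D `&` `]0, x].
    apply/seteqP; split=> y /=; rewrite !in_itv/=; last by case.
    by move=> /andP[y0 yx]; rewrite y0 yx (le_lt_trans yx).
  rewrite Rintegral_mkcondr; apply: eq_Rintegral => y /[!inE]/= yD.
  have yE : (y \in D `&` `]0, x]) = (y \in (`]0, x]%classic : set R)).
    by apply/idP/idP; rewrite !inE; [case|split].
  rewrite patchE indicE yE.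
  by case: ifPn; rewrite ?mulr1 ?mulr0.
apply: integrableS gi => // y /=; rewrite !in_itv/= => /andP[y0 yx].
by rewrite y0 (le_lt_trans yx).
Qed.

Lemma Rintegral_zext g : \int[mu]_(s in D) zext T g s = \int[mu]_(s in D) g s.
Proof.
by apply: eq_Rintegral => x; rewrite inE/= in_itv/= => xD; rewrite zextE.
Qed.

Lemma zext_intg g : intg g -> mu.-integrable `[0, T] (EFin \o zext T g).
Proof.
move=> gi; have zE : EFin \o zext T g = (EFin \o g) \_ D.
  apply/funext => x; rewrite /= patchE /zext.
  have -> : (x \in D) = (0 < x < T) by apply/idP/idP; rewrite inE/= in_itv.
  by case: ifP.
rewrite zE; apply/integrable_restrict => //.
by rewrite setIidr//; exact: subset_itv_oo_cc.
Qed.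

Lemma primitive_C0 g : intg g -> \int[mu]_(s in D) g s = 0 -> C0 T (primitive g).
Proof.
move=> gi g0; have zi := zext_intg gi.
have := parameterized_integral_continuous (ltW T_gt0) zi.
move=> /(continuous_within_itvP _ T_gt0)[c l r].
apply: (@C0_eq (primitive (zext T g))).
  move=> x xT; rewrite !primitiveE//.
    by apply: eq_Rintegral => y; rewrite inE/= in_itv/= => yD; rewrite zextE.
  by apply: integrableS zi => //; exact: subset_itv_oo_cc.
split=> //.
- move: l; rewrite /primitive /parameterized_integral.
  by rewrite (_ : `[0, 0]%classic = [set 0]) ?Rintegral_set1// set_itv1.
- move: r; rewrite /primitive /parameterized_integral -Rintegral_itv_obnd_cbnd.
    rewrite -Rintegral_itv_bndo_bndc ?Rintegral_zext ?g0//.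
    by apply: integrableS zi => //; exact: subset_itv_oo_cc.
  by apply: integrableS zi => //; exact: subset_itv_oc_cc.
Qed.

Lemma primitive_sub_le f g x : intg f -> intg g -> 0 < x < T ->
  `|primitive f x - primitive g x| <= \int[mu]_(s in D) `|f s - g s|.
Proof.
move=> fi gi xT; rewrite !primitiveE//.
have mi : measurable_fun D (\1_(`]0, x]%classic : set R) : R -> R).
  by apply: measurable_funTS; exact: measurable_indic.
have ib y : D y -> `|\1_(`]0, x]%classic : set R) y : R| <= 1.
  by move=> _; rewrite indicE; case: (_ \in _); rewrite ?normr1 ?normr0.
have fgi : intg (fun s => f s - g s) by exact: intgB.
have fi1 : intg (fun s => f s * \1_(`]0, x]%classic : set R) s) by exact: (@intgM _ _ _ _ _ _ _ _ 1).
have gi1 : intg (fun s => g s * \1_(`]0, x]%classic : set R) s) by exact: (@intgM _ _ _ _ _ _ _ _ 1).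
rewrite -RintegralB//.
rewrite -[leRHS]mulr1.
have -> : \int[mu]_(s in D) (f s * \1_`]0, x] s - g s * \1_`]0, x] s) =
    \int[mu]_(s in D) ((f s - g s) * \1_(`]0, x]%classic : set R) s).
  by apply: eq_Rintegral => y _; rewrite mulrBl.
exact: normr_RintegralM_le.
Qed.

Lemma primitive_Ccinfty psi : Ccinfty T psi -> \int[mu]_(s in D) psi s = 0 ->
  Ccinfty T (primitive psi) /\ forall x, is_derive x 1 (primitive psi) (psi x).
Proof.
move=> cpsi psi0; have [dpsi [a [b [a0 bT hab]]]] := cpsi.
have psi_a x : x < a -> psi x = 0.
  by move=> xa; apply/eqP; apply: contraT => /hab/andP[ax _]; rewrite ltNge ax in xa.
have psi_b x : b < x -> psi x = 0.
  by move=> bx; apply/eqP; apply: contraT => /hab/andP[_ xb]; rewrite ltNge xb in bx.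
have cont := Ccinfty_continuous cpsi.
have prim_a x : x < a -> primitive psi x = 0.
  move=> xa; rewrite /primitive.
  rewrite (@eq_Rintegral _ _ _ mu _ (fun=> 0)).
    by rewrite Rintegral_cst// mul0r.
  by move=> y; rewrite inE/= in_itv/= => /andP[_ yx]; rewrite psi_a// (le_lt_trans yx).
have dprim x : is_derive x 1 (primitive psi) (psi x).
  have [xa|ax] := ltP x a.
    rewrite psi_a//.
    apply: (@near_eq_is_derive R R R (cst 0) _ x 1 0 _ (is_derive_cst 0 x 1)).
    by near=> y; rewrite prim_a//; near: y; exact: lt_nbhsl.
  have i1 : mu.-integrable `[0, x + 1] (EFin \o psi).
    apply: continuous_compact_integrable; first exact: segment_compact.
    exact: continuous_subspaceT.
  have xx1 : x < x + 1 by rewrite ltrDl.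
  have [d1 d2] := continuous_FTC1_closed xx1 i1 (lt_le_trans a0 ax) (cont x).
  exact: (DeriveDef d1 (etrans (esym (derive1E _ _)) d2)).
have primT : primitive psi T = 0.
  have i0T : mu.-integrable `[0, T] (EFin \o psi).
    apply: continuous_compact_integrable; first exact: segment_compact.
    exact: continuous_subspaceT.
  rewrite /primitive -Rintegral_itv_obnd_cbnd; last first.
    by apply: integrableS i0T => //; exact: subset_itv_oc_cc.
  by rewrite -Rintegral_itv_bndo_bndc//; exact: continuous_intg.
have int0 p q : b < p -> \int[mu]_(s in `]p, q[) psi s = 0.
  move=> bp; rewrite (@eq_Rintegral _ _ _ mu _ (fun=> 0)).
    by rewrite Rintegral_cst// mul0r.
  by move=> y; rewrite inE/= in_itv/= => /andP[py _]; rewrite psi_b// (lt_trans bp).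
have prim_b x : b < x -> primitive psi x = 0.
  move=> bx; have [xT|Tx|->//] := ltgtP x T.
    by have := FTC_oo xT dprim cont; rewrite int0// primT sub0r => /esym/eqP; rewrite oppr_eq0 => /eqP.
  by have := FTC_oo Tx dprim cont; rewrite int0// primT subr0 => /esym.
split=> //; split.
  move=> [|n] x; first by have [] := dprim x.
  rewrite derive1Sn (_ : derive1 (primitive psi) = psi).
    exact: dpsi.
  by apply/funext => y; rewrite derive1E; have [] := dprim y.
exists a, b; split => // x; apply: contraNT.
by rewrite negb_and -!ltNge => /orP[/prim_a|/prim_b] ->.
Unshelve. all: by end_near. Qed.

Lemma Ccinfty_lin a phi psi : Ccinfty T phi -> Ccinfty T psi -> Ccinfty T (a *: phi + psi).
Proof.
move=> cp cq; have [dp [a1 [b1 [a10 b1T h1]]]] := cp.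
have [dq [a2 [b2 [a20 b2T h2]]]] := cq; split.
  have dlin N x : derivable (a *: derive1n N phi + derive1n N psi) x 1.
    by apply: derivableD; [apply: derivableZ; exact: dp|exact: dq].
  have E N : derive1n N (a *: phi + psi) = a *: derive1n N phi + derive1n N psi.
    elim: N => // N IH; rewrite !derive1nS IH; apply/funext => x.
    rewrite derive1E deriveD; [|by apply: derivableZ; exact: dp|exact: dq].
    by rewrite deriveZ ?[in RHS]fctE/= -?derive1E//; exact: dp.
  by move=> N x; rewrite E.
exists (Num.min a1 a2), (Num.max b1 b2); split.
- by rewrite lt_min a10.
- by rewrite gt_max b1T.
move=> x nz; rewrite ge_min le_max.
have [z|/h1/andP[-> ->]//] := eqVneq (phi x) 0.
have /h2/andP[-> ->] : psi x != 0 by move: nz; rewrite (_ : (a *: phi + psi) x = a * phi x + psi x)// z mulr0 add0r.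
by rewrite !orbT.
Qed.

Lemma integration_by_parts_BV u m g : intg u -> distributional_derivative T u m ->
  intg g -> \int[mu]_(s in D) g s = 0 ->
  m (primitive g) = - \int[mu]_(s in D) (u s * g s).
Proof.
move=> ui um gi g0; have [mM mE] := um.
have [M M0 uM] := BV_ess_bounded T_gt0 ui um.
have [B B0 hB] := M_bound T_gt0 mM.
have mu_u := intg_measurable ui.
have T0 : 0 < T := T_gt0.
pose b0 : R -> R := bump (T / 4) (T / 4).
have cb0 : Ccinfty T b0 by apply: bump_Ccinfty; lra.
have ib0 : \int[mu]_(s in D) b0 s = 1 by apply: Rintegral_bump => //; lra.
have b0i := Ccinfty_intg cb0.
pose beta0 := \int[mu]_(s in D) `|b0 s|.
have beta00 : 0 <= beta0 by apply: Rintegral_ge0.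
apply/eqP; rewrite -subr_eq0 opprK -normr_le0; apply/ler_addgt0Pl => e e0; rewrite addr0.
have K0 : 0 < (B + M) * (1 + beta0) + 1 by rewrite ltr_wpDl// mulr_ge0// addr_ge0.
have [psi cpsi hpsi] := Ccinfty_dense_L1 T_gt0 gi (divr_gt0 e0 K0).
have psii := Ccinfty_intg cpsi.
set e1 := e / _ in hpsi; pose s0 := \int[mu]_(s in D) psi s.
have s0e : `|s0| <= e1.
  have gpi : intg (fun s => g s - psi s) by exact: intgB.
  have -> : s0 = - \int[mu]_(s in D) (g s - psi s).
    by rewrite RintegralB// g0 sub0r opprK.
  by rewrite normrN (le_trans (le_normr_Rintegral _ gpi)).
pose psi' : R -> R := (- s0) *: b0 + psi.
have cpsi' : Ccinfty T psi' by exact: Ccinfty_lin.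
have psi'i := Ccinfty_intg cpsi'.
have sbi : intg (fun s => (- s0) * b0 s) by exact: intgZ.
have psi'0 : \int[mu]_(s in D) psi' s = 0.
  by rewrite RintegralD// RintegralZl// ib0 mulr1 addNr.
have close : \int[mu]_(s in D) `|g s - psi' s| <= e1 * (1 + beta0).
  rewrite mulrDr mulr1; apply: (le_trans (L1_triangle gi psii psi'i)).
  rewrite lerD//; apply: (@le_trans _ _ (`|s0| * beta0)); last by rewrite ler_wpM2r.
  rewrite -RintegralZl//; last exact: intg_norm.
  rewrite le_eqVlt; apply/orP; left; apply/eqP; apply: eq_Rintegral => x _.
  by rewrite /psi' fctE/= opprD addrCA subrr addr0 scaleNr opprK normrM.
have [cP dP] := primitive_Ccinfty cpsi' psi'0.
have mP : m (primitive psi') = - \int[mu]_(s in D) (u s * psi' s).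
  rewrite mE// dotL2E; congr (- _); apply: eq_Rintegral => x _.
  by rewrite derive1E (@derive_val _ _ _ _ _ _ _ (dP x)).
have gC0 := primitive_C0 gi g0; have PC0 := Ccinfty_C0 cP.
have di : intg (fun s => g s - psi' s) by exact: intgB.
have [ugi _] := intgM_ess M0 gi mu_u uM.
have [upi _] := intgM_ess M0 psi'i mu_u uM.
have [_ udi] := intgM_ess M0 di mu_u uM.
have E : m (primitive g) + \int[mu]_(s in D) (u s * g s) =
    m (primitive g - primitive psi') + \int[mu]_(s in D) ((g s - psi' s) * u s).
  rewrite (M_sub mM gC0 PC0) mP opprK.
  have -> : \int[mu]_(s in D) ((g s - psi' s) * u s) =
      \int[mu]_(s in D) (u s * g s) - \int[mu]_(s in D) (u s * psi' s).
    have ugi' : intg (fun s => u s * g s).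
      by apply: eq_intg ugi => // s _; rewrite mulrC.
    have upi' : intg (fun s => u s * psi' s).
      by apply: eq_intg upi => // s _; rewrite mulrC.
    by rewrite -RintegralB//; apply: eq_Rintegral => s _; rewrite mulrC mulrBr.
  ring.
rewrite E (le_trans (ler_normD _ _))//.
have A1 : `|m (primitive g - primitive psi')| <= B * (e1 * (1 + beta0)).
  rewrite (le_trans (hB _ (C0_sub gC0 PC0)))// ler_wpM2l// normC_le// => x xT.
  by rewrite (le_trans _ close)// primitive_sub_le.
have A2 := le_trans udi (ler_wpM2r M0 close).
rewrite (le_trans (lerD A1 A2))//.
have -> : B * (e1 * (1 + beta0)) + e1 * (1 + beta0) * M = e1 * ((B + M) * (1 + beta0)) by ring.
rewrite /e1 mulrAC ler_pdivrMr// ler_wpM2l ?(ltW e0)//.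
by rewrite lerDl.
Qed.

End Primitive.

(** * The atoms and the total generalized variation *)

Section Atoms.
Context {R : realType}.
Variable T : R.
Hypothesis T_gt0 : 0 < T.
Implicit Types (f u v w g phi psi : R -> R) (x y e a b c h M : R).
Implicit Types (m n : (R -> R) -> R).

Local Notation mu := (@lebesgue_measure R).
Local Notation D := (`]0, T[%classic : set R).
Local Notation intg u := (mu.-integrable D (EFin \o u)).

Lemma indic_bound (A : set R) x : `|\1_A x : R| <= 1.
Proof. by rewrite indicE; case: (_ \in _); rewrite ?normr1 ?normr0. Qed.

Lemma indic_intg a b : intg (\1_(`]a, b[%classic : set R) : R -> R).
Proof.
apply: (@intg_bounded _ _ _ _ _ _ _ 1).
- by [].
- exact: muD_finite.
- by apply: measurable_funTS; exact: measurable_indic.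
- by move=> x _; exact: indic_bound.
Qed.

Lemma Rintegral_indicM (A : set R) f : A `<=` D ->
  \int[mu]_(x in D) (\1_A x * f x) = \int[mu]_(x in A) f x.
Proof.
move=> AD; rewrite -[in RHS](setIidr AD) Rintegral_mkcondr.
by apply: eq_Rintegral => y _; rewrite patchE indicE; case: ifPn; rewrite ?mul1r ?mul0r.
Qed.

Lemma affine_continuous c d : continuous (fun x : R => c * x + d).
Proof.
move=> x; apply: (@continuousD _ R _ (fun x => c * x) (fun=> d)); last exact: cst_continuous.
exact: mulrl_continuous.
Qed.

Lemma affine_parts phi c d a b : Ccinfty T phi -> a < b ->
  \int[mu]_(x in `]a, b[) ((c * x + d) * derive1 phi x) =
  (c * b + d) * phi b - (c * a + d) * phi a - c * \int[mu]_(x in `]a, b[) phi x.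
Proof.
move=> cphi ab; have cphi' := Ccinfty_continuous (Ccinfty_derive cphi).
have cont := Ccinfty_continuous cphi.
have dF x : is_derive x 1 (fun y : R => (c * y + d) * phi y)
    ((c * x + d) * derive1 phi x + c * phi x).
  have dphi := Ccinfty_is_derive x cphi.
  have daff : is_derive x 1 (fun y : R => c * y + d) c.
    have /is_derive_eq := is_deriveD (is_deriveZ c (is_derive_id x (1 : R))) (is_derive_cst d x 1).
    by apply; rewrite addr0 [_ *: _]mulr1.
  have /is_derive_eq := is_deriveM daff dphi; apply.
  by rewrite /GRing.scale/= [phi x * c]mulrC.
have c1 : continuous (fun x : R => (c * x + d) * derive1 phi x).
  move=> x; apply: (@continuousM _ R (fun x => c * x + d) (derive1 phi)).
    exact: affine_continuous.
  exact: cphi'.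
have c2 : continuous (fun x : R => c * phi x).
  by move=> x; apply: (@continuousM _ R (fun=> c) phi); [exact: cst_continuous|exact: cont].
have I : \int[mu]_(x in `]a, b[) (c * phi x) = c * \int[mu]_(x in `]a, b[) phi x.
  by rewrite RintegralZl//; exact: continuous_intg.
have S : \int[mu]_(x in `]a, b[) ((c * x + d) * derive1 phi x + c * phi x) =
    \int[mu]_(x in `]a, b[) ((c * x + d) * derive1 phi x) +
    \int[mu]_(x in `]a, b[) (c * phi x).
  by rewrite RintegralD//; exact: continuous_intg.
rewrite -I -(FTC_oo ab dF); first by rewrite S addrK.
by move=> x; apply: (@continuousD _ R _ _ _ _ (c1 x) (c2 x)).
Qed.

Definition dirac_at x : (R -> R) -> R := fun phi => phi x.

Lemma dirac_Mspace x : 0 < x < T -> Mspace T (dirac_at x).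
Proof. by move=> xT; split=> //; exists 1 => phi c; rewrite mul1r; exact: normC_ge. Qed.

Lemma affine_L1 c d : L1 T (fun x => c * x + d).
Proof.
apply/L1P; split; last exact/continuous_intg/affine_continuous.
by apply: continuous_measurable_fun; exact: affine_continuous.
Qed.

Lemma affine_derivative c d :
  distributional_derivative T (fun x => c * x + d) (density T (fun=> c)).
Proof.
have ci : intg (fun=> c) by apply: continuous_intg; exact: cst_continuous.
split; first exact: density_Mspace.
move=> phi cphi; rewrite densityE dotL2E (affine_parts c d cphi T_gt0).
have phi0 := Ccinfty_out (x := 0) cphi; have phiT := Ccinfty_out (x := T) cphi.
rewrite phi0 ?ltxx// phiT ?ltxx ?andbF// !mulr0 subrr sub0r opprK RintegralZl//.
exact: Ccinfty_intg.
Qed.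

Lemma cst0_derivative : distributional_derivative T 0 (fun=> 0).
Proof.
split; first exact: Mspace_0.
move=> phi cphi; rewrite dotL2E -[LHS](mul0r (- fine (mu D))) mulrN -Rintegral_cst//.
by congr (- _); apply: eq_Rintegral => x _; rewrite mul0r.
Qed.

Lemma Sfun_L1 x : L1 T (Sfun T x).
Proof. by apply/L1P; split; [exact: measurable_indic|exact: indic_intg]. Qed.

Lemma Sfun_derivative x : 0 < x < T -> distributional_derivative T (Sfun T x) (dirac_at x).
Proof.
move=> /[dup] xD /andP[x0 xT]; split; first exact: dirac_Mspace.
move=> phi cphi; rewrite dotL2E Rintegral_indicM; last first.
  by move=> y /=; rewrite !in_itv/= => /andP[xy ->]; rewrite (lt_trans x0).
have := affine_parts 0 1 cphi xT.
under eq_Rintegral do rewrite mul0r add0r mul1r.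
move=> ->; rewrite !mul0r !add0r !mul1r subr0.
by rewrite (Ccinfty_out (x := T) cphi) ?ltxx ?andbF// sub0r opprK.
Qed.

Definition Kslope x : R -> R :=
  if x < T / 2 then - (\1_(`]0, x[%classic : set R) : R -> R) else Sfun T x.

Lemma Kslope_L1 x : L1 T (Kslope x).
Proof.
rewrite /Kslope; case: ifP => _; last exact: Sfun_L1.
apply/L1P; split; first by apply: measurable_funN; exact: measurable_indic.
have h : intg (fun y => (-1) * \1_(`]0, x[%classic : set R) y : R).
  by apply: intgZ => //; exact: indic_intg.
by apply: eq_intg h => // y _; rewrite mulN1r.
Qed.

Lemma Kfun_L1 x : L1 T (Kfun T x).
Proof.
have aff a b : measurable_fun setT (fun y : R => a * y + b).
  by apply: continuous_measurable_fun; exact: affine_continuous.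
have mK : measurable_fun setT (Kfun T x).
  rewrite /Kfun; case: (x < T / 2).
    apply: measurable_funM; first exact: measurable_indic.
    by rewrite (_ : (fun _ => _) = fun y => (-1) * y + x)//; apply/funext => y; ring.
  apply: measurable_funM; first exact: measurable_indic.
  by rewrite (_ : (fun _ => _) = fun y => 1 * y + (- x))//; apply/funext => y; ring.
apply/L1P; split => //.
apply: (@intg_bounded _ _ _ _ _ _ _ (`|x| + T)) => //.
- exact: muD_finite.
- exact: measurable_funTS.
- move=> y; rewrite /= in_itv/= => /andP[y0 yT].
  have h z : `|z| <= `|x| + T -> forall A : set R, `|\1_A y * z| <= `|x| + T.
    by move=> hz A; rewrite normrM (le_trans _ hz)// ler_piMl// indic_bound.
  rewrite /Kfun; case: ifP => _; apply: h.
    by rewrite (le_trans (ler_normB _ _))// lerD2l ger0_norm ltW.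
  by rewrite (le_trans (ler_normB _ _))// addrC lerD2l ger0_norm ltW.
Qed.

Lemma Kslope_derivative x : 0 < x < T -> distributional_derivative T (Kslope x) (dirac_at x).
Proof.
move=> /[dup] xD /andP[x0 xT]; rewrite /Kslope; case: ifP => _; last exact: Sfun_derivative.
split; first exact: dirac_Mspace.
move=> phi cphi; have c' := Ccinfty_continuous (Ccinfty_derive cphi).
have -> : dotL2 T (- (\1_(`]0, x[%classic : set R) : R -> R)) (derive1 phi) =
    - \int[mu]_(y in `]0, x[) derive1 phi y.
  rewrite dotL2E -[RHS]mulN1r -RintegralZl//; last exact: continuous_intg.
  rewrite -(@Rintegral_indicM `]0, x[%classic); last first.
    by move=> y /=; rewrite !in_itv/= => /andP[-> yx]; rewrite (lt_trans yx).
  by apply: eq_Rintegral => y _; rewrite mulN1r mulrN -mulNr.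
rewrite opprK.
have := affine_parts 0 1 cphi x0.
under eq_Rintegral do rewrite mul0r add0r mul1r.
move=> ->; rewrite !mul0r !add0r !mul1r subr0.
by rewrite (Ccinfty_out (x := 0) cphi) ?ltxx// subr0.
Qed.

Lemma Kfun_derivative x : 0 < x < T ->
  distributional_derivative T (Kfun T x) (density T (Kslope x)).
Proof.
move=> /andP[x0 xT]; have /L1P[_ ki] := Kslope_L1 x.
split; first exact: density_Mspace.
move=> phi cphi; rewrite densityE dotL2E /Kfun /Kslope; case: ifP => _.
- have sub : (`]0, x[%classic : set R) `<=` D.
    by move=> y /=; rewrite !in_itv/= => /andP[-> yx]; rewrite (lt_trans yx).
  have -> : \int[mu]_(y in D) ((- \1_(`]0, x[%classic : set R)) y * phi y) =
      \int[mu]_(y in D) (\1_(`]0, x[%classic : set R) y * ((-1) * phi y)).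
    by apply: eq_Rintegral => y _; rewrite mulN1r mulrN -mulNr.
  under [in RHS]eq_Rintegral do rewrite -mulrA.
  rewrite !Rintegral_indicM// RintegralZl//; last by apply: continuous_intg; exact: (Ccinfty_continuous cphi).
  have := affine_parts (-1) x cphi x0.
  have -> : \int[mu]_(y in `]0, x[) ((-1 * y + x) * derive1 phi y) =
     \int[mu]_(y in `]0, x[) ((x - y) * derive1 phi y).
    by apply: eq_Rintegral => y _; rewrite mulN1r addrC.
  move=> ->; rewrite (Ccinfty_out (x := 0) cphi) ?ltxx//; ring.
- have sub : (`]x, T[%classic : set R) `<=` D.
    by move=> y /=; rewrite !in_itv/= => /andP[xy ->]; rewrite (lt_trans x0).
  under [in RHS]eq_Rintegral do rewrite -mulrA.
  rewrite !Rintegral_indicM//.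
  have := affine_parts 1 (- x) cphi xT.
  have -> : \int[mu]_(y in `]x, T[) ((1 * y + - x) * derive1 phi y) =
     \int[mu]_(y in `]x, T[) ((y - x) * derive1 phi y).
    by apply: eq_Rintegral => y _; rewrite mul1r.
  by move=> ->; rewrite (Ccinfty_out (x := T) cphi) ?ltxx ?andbF//; ring.
Qed.

Section Pairing.
Variable g : R -> R.
Hypothesis gi : intg g.
Hypothesis g_cst : \int[mu]_(x in D) g x = 0.
Hypothesis g_id : \int[mu]_(x in D) (x * g x) = 0.

Let p := primitive g.
Let P := fun x => - primitive p x.

Lemma dual_p_C0 : C0 T p.
Proof. exact: primitive_C0. Qed.

Lemma Rintegral_dual_p : \int[mu]_(x in D) p x = 0.
Proof.
have /L1P[_ idi] := affine_L1 1 0.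
have := integration_by_parts_BV T_gt0 idi (affine_derivative 1 0) gi g_cst.
rewrite densityE; under eq_Rintegral do rewrite mul1r.
under [in RHS]eq_Rintegral do rewrite mul1r addr0.
by rewrite g_id oppr0.
Qed.

Lemma primitive_dual_C0 : C0 T (primitive p).
Proof.
by apply: primitive_C0 => //; [exact: C0_intg dual_p_C0|exact: Rintegral_dual_p].
Qed.

Lemma dual_P_C0 : C0 T P.
Proof.
have := C0_scale (-1) primitive_dual_C0.
by rewrite (_ : -1 *: primitive p = P)//; apply/funext => x; exact: mulN1r.
Qed.

Lemma pairingE u w m n : intg u -> intg w ->
  distributional_derivative T u m -> distributional_derivative T w n ->
  \int[mu]_(x in D) (u x * g x) = - (m p - density T w p) - n P.
Proof.
move=> ui wi um wn.
have E1 := integration_by_parts_BV T_gt0 ui um gi g_cst.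
have E2 := integration_by_parts_BV T_gt0 wi wn (C0_intg T_gt0 dual_p_C0) Rintegral_dual_p.
have -> : n P = - n (primitive p).
  have [nM _] := wn; rewrite -mulN1r -(M_scale (-1) nM primitive_dual_C0).
  by congr n; apply/funext => x; exact: esym (mulN1r _).
rewrite -/p in E1; rewrite E1 E2 densityE; ring.
Qed.

Lemma pairing_Sfun x : 0 < x < T -> \int[mu]_(y in D) (Sfun T x y * g y) = - p x.
Proof.
move=> xT; have /L1P[_ si] := Sfun_L1 x.
have zi : intg 0 by exact: L2_intg (L2_0 T).
rewrite (pairingE si zi (Sfun_derivative xT) cst0_derivative) subr0.
have -> : density T 0 p = 0.
  rewrite densityE -[RHS](mul0r (fine (mu D))) -Rintegral_cst//.
  by apply: eq_Rintegral => y _; rewrite mul0r.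
by rewrite subr0.
Qed.

Lemma pairing_Kfun x : 0 < x < T -> \int[mu]_(y in D) (Kfun T x y * g y) = - P x.
Proof.
move=> xT; have /L1P[_ ki] := Kfun_L1 x; have /L1P[_ ki'] := Kslope_L1 x.
rewrite (pairingE ki ki' (Kfun_derivative xT) (Kslope_derivative xT)).
by rewrite subrr oppr0 sub0r.
Qed.

End Pairing.

End Atoms.

Section TotalGeneralizedVariation.
Context {R : realType}.
Variables (T alpha beta : R).
Hypotheses (T_gt0 : 0 < T) (alpha_gt0 : 0 < alpha) (beta_gt0 : 0 < beta).
Implicit Types (f u v w g phi psi : R -> R) (x y e a b c h M : R).
Implicit Types (m n nu : (R -> R) -> R).

Local Notation mu := (@lebesgue_measure R).
Local Notation D := (`]0, T[%classic : set R).
Local Notation intg u := (mu.-integrable D (EFin \o u)).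

Definition M_le m b := Mspace T m /\ forall phi, C0 T phi -> `|m phi| <= b * normC T phi.

Lemma M_le_lin a m n b c : M_le m b -> M_le n c ->
  M_le (fun phi => a * m phi + n phi) (`|a| * b + c).
Proof.
move=> [mM mb] [nM nc]; split; first exact: Mspace_lin.
move=> phi cp; rewrite mulrDl (le_trans (ler_normD _ _))// lerD ?nc//.
by rewrite normrM -mulrA ler_wpM2l// mb.
Qed.

Lemma M_le_0 : M_le (fun=> 0) 0.
Proof. by split; [exact: Mspace_0|move=> phi _; rewrite normr0 mul0r]. Qed.

Lemma M_le_dirac x : 0 < x < T -> M_le (dirac_at x) 1.
Proof.
by move=> xT; split; [exact: dirac_Mspace|move=> phi c; rewrite mul1r; exact: normC_ge].
Qed.

Lemma L1_lin a u v : L1 T u -> L1 T v -> L1 T (a *: u + v).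
Proof.
move=> uL vL; have [_] := Lfun_submod_closed (muT T) (lexx 1%E); exact.
Qed.

(* The decomposition Du = nu + w witnesses TGV u <= c; unlike TGV itself, this relation
   does not involve the choice made by [BVderiv]. *)
Definition tgv_le u c : Prop := L1 T u /\
  exists w nu n b1 b2, [/\ L1 T w,
    distributional_derivative T u (fun phi => nu phi + density T w phi),
    distributional_derivative T w n,
    M_le nu b1 /\ M_le n b2 & [/\ 0 <= b1, 0 <= b2 & alpha * b1 + beta * b2 <= c]].

Lemma distributional_derivative_ext u m n : Mspace T n ->
  (forall phi, C0 T phi -> m phi = n phi) ->
  distributional_derivative T u m -> distributional_derivative T u n.
Proof.
move=> nM mn [mM mE]; split=> // phi cp.
by rewrite -mn ?mE//; exact: Ccinfty_C0.
Qed.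

Lemma Mspace_add m n : Mspace T m -> Mspace T n -> Mspace T (fun phi => m phi + n phi).
Proof.
move=> mM nM; rewrite (_ : (fun _ => _) = fun phi => 1 * m phi + n phi).
  exact: Mspace_lin.
by apply/funext => phi; rewrite mul1r.
Qed.

Lemma tgv_le_lin a u v c c' : tgv_le u c -> tgv_le v c' ->
  tgv_le (a *: u + v) (`|a| * c + c').
Proof.
move=> [uL [w [nu [n [b1 [b2 [wL du dw [nub nb] [b10 b20 hc]]]]]]]].
move=> [vL [w' [nu' [n' [b1' [b2' [wL' dv dw' [nub' nb'] [b10' b20' hc']]]]]]]].
have /L1P[_ ui] := uL; have /L1P[_ vi] := vL.
have /L1P[_ wi] := wL; have /L1P[_ wi'] := wL'.
split; first exact: L1_lin.
exists (a *: w + w'), (fun phi => a * nu phi + nu' phi), (fun phi => a * n phi + n' phi).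
exists (`|a| * b1 + b1'), (`|a| * b2 + b2'); split.
- exact: L1_lin.
- have wwi : intg (a *: w + w') by have /L1P[] := L1_lin a wL wL'.
  apply: distributional_derivative_ext (distributional_derivative_lin T_gt0 a ui vi du dv) => //.
    apply: Mspace_add; last exact: density_Mspace.
    by apply: Mspace_lin => //; [case: nub|case: nub'].
  by move=> phi cp; rewrite density_lin//; ring.
- exact: distributional_derivative_lin.
- by split; exact: M_le_lin.
- split; [by rewrite addr_ge0// mulr_ge0|by rewrite addr_ge0// mulr_ge0|].
  have := ler_wpM2l (normr_ge0 a) hc; move: (`|a|) => r; nra.
Qed.

Lemma tgv_le_trans u c c' : c <= c' -> tgv_le u c -> tgv_le u c'.
Proof.
move=> cc' [uL [w [nu [n [b1 [b2 [? ? ? ? [? ? hc]]]]]]]]; split=> //.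
by exists w, nu, n, b1, b2; split=> //; split=> //; exact: le_trans cc'.
Qed.

Lemma tgv_le_affine c d : tgv_le (fun x => c * x + d) 0.
Proof.
split; first exact: affine_L1.
exists (fun x => 0 * x + c), (fun=> 0), (density T (fun=> 0)), 0, 0; split=> //.
- exact: affine_L1.
- have h : (fun=> c) = (fun x : R => 0 * x + c) by apply/funext => x; rewrite mul0r add0r.
  rewrite (_ : (fun phi => _) = density T (fun x => 0 * x + c)).
    by rewrite -h; exact: affine_derivative.
  by apply/funext => phi; rewrite add0r.
- exact: affine_derivative.
- split; first exact: M_le_0.
  have zi : intg (fun=> 0 : R) by apply: continuous_intg; exact: cst_continuous.
  split; first exact: density_Mspace.
  move=> phi _; rewrite densityE mul0r; under eq_Rintegral do rewrite mul0r.
  by rewrite Rintegral_cst// mul0r normr0.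
- by split=> //; rewrite !mulr0 addr0.
Qed.

Lemma tgv_le_0 : tgv_le 0 0.
Proof.
have := tgv_le_affine 0 0; rewrite (_ : (fun x : R => 0 * x + 0) = 0)//.
by apply/funext => x; rewrite mul0r addr0.
Qed.

Lemma tgv_le_scale a u c : tgv_le u c -> tgv_le (a *: u) (`|a| * c).
Proof. by move=> h; have := tgv_le_lin a h tgv_le_0; rewrite !addr0. Qed.

Lemma tgv_le_Sfun x : 0 < x < T -> tgv_le (Sfun T x) alpha.
Proof.
move=> xT; split; first exact: Sfun_L1.
have zi : intg (0 : R -> R) by exact: L2_intg (L2_0 T).
exists 0, (dirac_at x), (fun=> 0), 1, 0; split => //.
- exact: L2_L1 (L2_0 T).
- apply: distributional_derivative_ext (Sfun_derivative T_gt0 xT).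
    by apply: Mspace_add; [exact: dirac_Mspace|exact: density_Mspace].
  move=> phi cp; rewrite densityE; under eq_Rintegral do rewrite mul0r.
  by rewrite Rintegral_cst// mul0r addr0.
- exact: cst0_derivative.
- by split; [exact: M_le_dirac|exact: M_le_0].
- by split=> //; rewrite mulr1 mulr0 addr0.
Qed.

Lemma tgv_le_Kfun x : 0 < x < T -> tgv_le (Kfun T x) beta.
Proof.
move=> xT; split; first exact: Kfun_L1.
have /L1P[_ ki] := Kslope_L1 T x.
exists (Kslope T x), (fun=> 0), (dirac_at x), 0, 1; split => //.
- exact: Kslope_L1.
- apply: distributional_derivative_ext (Kfun_derivative T_gt0 xT).
    by apply: Mspace_add; [exact: Mspace_0|exact: density_Mspace].
  by move=> phi cp; rewrite add0r.
- exact: Kslope_derivative.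
- by split; [exact: M_le_0|exact: M_le_dirac].
- by split=> //; rewrite mulr1 mulr0 add0r.
Qed.

Let tgv_set u := [set alpha * normM T (BVderiv T u - density T w) + beta * normM T (BVderiv T w)
      | w in BV T].

Lemma BV_intg u : BV T u -> intg u.
Proof. by move=> [/L1P[]]. Qed.

Lemma BVderiv_sub_Mspace u w : BV T u -> BV T w ->
  Mspace T (BVderiv T u - density T w).
Proof.
move=> uB wB; apply: Mspace_sub => //; first by have [] := BVderivP uB.
by apply: density_Mspace => //; exact: BV_intg.
Qed.

Lemma tgv_set_ge0 u c : BV T u -> tgv_set u c -> 0 <= c.
Proof.
move=> uB [w wB <-]; rewrite addr_ge0// mulr_ge0 ?(ltW alpha_gt0) ?(ltW beta_gt0)//.
  by apply: normM_ge0 => //; exact: BVderiv_sub_Mspace.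
by apply: normM_ge0 => //; have [] := BVderivP wB.
Qed.

Lemma BV_0 : BV T 0.
Proof.
by split; [exact: L2_L1 (L2_0 T)|exists (fun=> 0); exact: cst0_derivative].
Qed.

Lemma TGV_ge u c : (forall d, tgv_set u d -> c <= d) -> c <= TGV T alpha beta u.
Proof.
move=> h; apply: lb_le_inf; last by move=> d /h.
by eexists; exists 0; first exact: BV_0.
Qed.

Lemma TGV_ge0 u : BV T u -> 0 <= TGV T alpha beta u.
Proof. by move=> uB; apply: TGV_ge => d; exact: tgv_set_ge0. Qed.

Lemma tgv_le_TGV u c : tgv_le u c -> BV T u /\ TGV T alpha beta u <= c.
Proof.
move=> [uL [w [nu [n [b1 [b2 [wL du dw [[nuM nub] [nM nb]] [b10 b20 hc]]]]]]]].
have uB : BV T u by split=> //; exists (fun phi => nu phi + density T w phi).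
have wB : BV T w by split=> //; exists n.
split=> //; apply: le_trans hc; apply: le_trans (_ : alpha * normM T (BVderiv T u - density T w) +
  beta * normM T (BVderiv T w) <= _).
  apply: ge_inf; last by exists w.
  by exists 0 => d; exact: tgv_set_ge0.
rewrite lerD// ler_wpM2l ?(ltW alpha_gt0) ?(ltW beta_gt0)//.
  apply: normM_le => // phi cp.
  have -> : (BVderiv T u - density T w) phi = BVderiv T u phi - density T w phi by [].
  by rewrite (BVderivE T_gt0 du cp) addrK; exact: nub.
by apply: normM_le => // phi cp; rewrite (BVderivE T_gt0 dw cp); exact: nb.
Qed.

Lemma pairing_le_TGV g u M : intg g -> \int[mu]_(x in D) g x = 0 ->
  \int[mu]_(x in D) (x * g x) = 0 -> 0 < M ->
  normC T (primitive g) <= alpha * M ->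
  normC T (fun x => - primitive (primitive g) x) <= beta * M ->
  BV T u -> `|\int[mu]_(x in D) (u x * g x)| <= M * TGV T alpha beta u.
Proof.
move=> gi g1 gx M0 pM PM uB; rewrite -ler_pdivrMl//; apply: TGV_ge => _ [w wB <-].
rewrite ler_pdivrMl//.
have dw := BVderivP wB; have [dwM _] := dw.
rewrite (pairingE T_gt0 gi g1 gx (BV_intg uB) (BV_intg wB) (BVderivP uB) dw).
have pC := dual_p_C0 T_gt0 gi g1; have PC := dual_P_C0 T_gt0 gi g1 gx.
rewrite (le_trans (ler_normB _ _))// normrN mulrDr lerD//.
  rewrite (le_trans (normM_ge T_gt0 (BVderiv_sub_Mspace uB wB) pC))//.
  rewrite mulrC mulrA [M * _]mulrC ler_wpM2r//.
  by apply: normM_ge0 => //; exact: BVderiv_sub_Mspace.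
rewrite (le_trans (normM_ge T_gt0 dwM PC))//.
by rewrite mulrC mulrA [M * _]mulrC ler_wpM2r// normM_ge0.
Qed.

End TotalGeneralizedVariation.

(** * Convexity and the descent lemma *)

Section InnerProduct.
Context {R : realType}.
Variable T : R.
Implicit Types (u v w : R -> R) (a : R).

Lemma dotL2_0l w : dotL2 T 0 w = 0.
Proof.
rewrite dotL2E -[RHS](mul0r (fine (lebesgue_measure (`]0, T[%classic : set R)))).
by rewrite -Rintegral_cst//; apply: eq_Rintegral => y _; rewrite mul0r.
Qed.

Lemma dotL2_0r w : dotL2 T w 0 = 0.
Proof. by rewrite dotL2C dotL2_0l. Qed.

Lemma dotL2Zr a u w : L2 T u -> L2 T w -> dotL2 T w (a *: u) = a * dotL2 T w u.
Proof.
move=> uL wL; rewrite -[a *: u]addr0 dotL2_linr ?dotL2_0r ?addr0//.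
  exact: L2_mul_intg.
exact: L2_mul_intg wL (L2_0 T).
Qed.

Lemma dotL2Dr u v w : L2 T u -> L2 T v -> L2 T w ->
  dotL2 T w (u + v) = dotL2 T w u + dotL2 T w v.
Proof.
move=> uL vL wL; rewrite -[u]scale1r dotL2_linr ?scale1r ?mul1r//.
  exact: L2_mul_intg.
exact: L2_mul_intg.
Qed.

Lemma dotL2Br u v w : L2 T u -> L2 T v -> L2 T w ->
  dotL2 T w (u - v) = dotL2 T w u - dotL2 T w v.
Proof.
move=> uL vL wL; rewrite dotL2Dr//; last exact: L2_opp.
by rewrite -scaleN1r dotL2Zr// mulN1r.
Qed.

End InnerProduct.

Section Gradient.
Context {R : realType}.
Variables (T : R) (f : (R -> R) -> R).
Implicit Types (u v g h : R -> R) (t c e L : R).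

Lemma gradient_dir u g h e : is_gradient T f u g -> L2 T u -> L2 T h -> 0 < e ->
  exists2 d, 0 < d & forall t, 0 <= t <= d ->
  `|f (u + t *: h) - f u - t * dotL2 T g h| <= e * t.
Proof.
move=> [gL [A [Alin Afr] Ag]] uL hL e0.
have n0 := normL2_ge0 T h; have n1 : 0 < normL2 T h + 1 by rewrite ltr_wpDl.
have [d d0 dP] := Afr _ (divr_gt0 e0 n1).
exists (d / (normL2 T h + 1)); first exact: divr_gt0.
move=> t /andP[t0 td]; have thL := L2_scale t hL.
have nt : normL2 T (t *: h) = t * normL2 T h by rewrite normL2Z// ger0_norm.
have Ath : A (t *: h) = t * dotL2 T g h.
  by rewrite Ag// dotL2Zr.
have := dP (t *: h) thL; rewrite nt Ath => /(_ _)/le_trans; apply.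
  rewrite (@le_trans _ _ (t * (normL2 T h + 1)))//.
    by rewrite ler_wpM2l// lerDl.
  by rewrite -ler_pdivlMr.
rewrite mulrAC mulrA -[leRHS]mulr1 -mulrA ler_wpM2l ?mulr_ge0 ?(ltW e0)//.
by rewrite ler_pdivrMr// mul1r lerDl.
Qed.

Lemma convex_gradient u v g : convexL2 T f -> is_gradient T f u g ->
  L2 T u -> L2 T v -> f u + dotL2 T g (v - u) <= f v.
Proof.
move=> cf ug uL vL; apply/ler_addgt0Pl => e e0.
have [d d0 dP] := gradient_dir ug uL (L2_sub vL uL) e0.
pose t := Num.min d 1; have t0 : 0 < t by rewrite lt_min d0 ltr01.
have td : 0 <= t <= d by rewrite ltW//= ge_min lexx.
have t1 : 0 <= t <= 1 by rewrite ltW//= ge_min lexx orbT.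
have := cf v u t vL uL t1.
have -> : t *: v + (1 - t) *: u = u + t *: (v - u).
  by rewrite scalerBl scale1r scalerBr addrCA.
have := dP t td; rewrite ler_norml => /andP[h1 _] h2.
rewrite -(ler_pM2l t0); move: h1 h2.
move: (f (u + _)) (f u) (f v) (dotL2 _ _ _) => a b c p; nra.
Qed.

Lemma first_order u g h c : is_gradient T f u g -> L2 T u -> L2 T h ->
  (forall t, 0 <= t <= 1 -> f u <= f (u + t *: h) + t * c) -> 0 <= dotL2 T g h + c.
Proof.
move=> ug uL hL opt; apply/ler_addgt0Pl => e e0.
have [d d0 dP] := gradient_dir ug uL hL e0.
pose t := Num.min d 1; have t0 : 0 < t by rewrite lt_min d0 ltr01.
have td : 0 <= t <= d by rewrite ltW//= ge_min lexx.
have t1 : 0 <= t <= 1 by rewrite ltW//= ge_min lexx orbT.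
have := opt t t1; have := dP t td; rewrite ler_norml => /andP[_ h1] h2.
rewrite -(ler_pM2l t0) mulr0; move: h1 h2.
move: (f (u + _)) (f u) (dotL2 _ _ _) => a b p; nra.
Qed.

Lemma descent (gradf : (R -> R) -> R -> R) L u h : convexL2 T f ->
  (forall u, L2 T u -> is_gradient T f u (gradf u)) -> 0 <= L ->
  (forall u v, L2 T u -> L2 T v ->
    normL2 T (gradf u - gradf v) <= L * normL2 T (u - v)) ->
  L2 T u -> L2 T h ->
  f (u + h) <= f u + dotL2 T (gradf u) h + L / 2 * normL2 T h ^+ 2.
Proof.
move=> cf gradP L0 lip uL hL.
set s := dotL2 T (gradf u) h; set q := L * normL2 T h ^+ 2.
have q0 : 0 <= q by rewrite mulr_ge0// sqr_ge0.
(* Convexity at the end point of each of N small steps; the bounds sum up to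
   q / 2 * (1 + 1 / N). *)
have stepP t r : 0 <= t -> 0 <= r ->
    f (u + (t + r) *: h) <= f (u + t *: h) + r * (s + (t + r) * q).
  move=> t0 r0; set v := u + (t + r) *: h.
  have vL : L2 T v by apply: L2_add => //; exact: L2_scale.
  have wL : L2 T (u + t *: h) by apply: L2_add => //; exact: L2_scale.
  have := convex_gradient cf (gradP v vL) vL wL.
  have -> : u + t *: h - v = (- r) *: h.
    by rewrite /v opprD addrACA subrr add0r -scalerBl opprD addNKr.
  have [gvL _] := gradP v vL; have [guL _] := gradP u uL.
  rewrite dotL2Zr//.
  have gvh : dotL2 T (gradf v) h <= s + (t + r) * q.
    have -> : dotL2 T (gradf v) h = dotL2 T (gradf v - gradf u) h + s.
      by rewrite /s !(dotL2C _ _ h) dotL2Br// subrK.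
    rewrite addrC lerD2l (le_trans (ler_norm _))// (le_trans (cauchy_schwarz _ hL))//.
      exact: L2_sub.
    apply: (@le_trans _ _ (L * normL2 T (v - u) * normL2 T h)).
      by rewrite ler_wpM2r ?normL2_ge0// lip.
    have -> : v - u = (t + r) *: h by rewrite /v addrAC subrr add0r.
    rewrite normL2Z// ger0_norm ?addr_ge0// /q le_eqVlt; apply/orP; left; apply/eqP; ring.
  have := ler_wpM2l r0 gvh.
  move: (f v) (f (u + t *: h)) (dotL2 _ _ h) (s + _) => a b p r'; nra.
have sub N : (0 < N)%N -> f (u + h) <= f u + s + q / 2 * (1 + N%:R^-1).
  move=> N0; have dN : N%:R * (N%:R^-1 : R) = 1 by rewrite mulfV// pnatr_eq0 -lt0n.
  have d0 : 0 <= (N%:R^-1 : R) by rewrite invr_ge0.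
  move: (N%:R^-1 : R) dN d0 => d dN d0.
  have ind i : f (u + (i%:R * d) *: h) <= f u + i%:R * d * s +
      q / 2 * (i%:R * d) * (i%:R * d + d).
    elim: i => [|i IH].
      by rewrite !mul0r scale0r addr0 mulr0 mul0r !addr0.
    rewrite -natr1 mulrDl mul1r; have := stepP (i%:R * d) d; rewrite mulr_ge0// => /(_ isT d0).
    move/le_trans; apply.
    apply: (le_trans (lerD IH (lexx _))); rewrite le_eqVlt; apply/orP; left; apply/eqP; by field.
  by have := ind N; rewrite dN scale1r !mul1r mulr1.
apply/ler_addgt0Pl => e e0.
pose N := (Num.truncn (q / e)).+1.
have N0 : 0 < N%:R :> R by rewrite ltr0n.
have qN : q / N%:R <= e.
  rewrite ler_pdivrMr// mulrC -ler_pdivrMr//.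
  by have /truncn_itv/andP[_ /ltW] : 0 <= q / e by rewrite divr_ge0// ltW.
have := sub N isT; rewrite mulrDr mulr1.
have : q / 2 / N%:R <= e by rewrite mulrAC ler_pdivrMr// (le_trans qN)//; lra.
have -> : L / 2 * normL2 T h ^+ 2 = q / 2 by rewrite /q; ring.
move: (f (u + h)) (q / 2 / N%:R) (q / 2) => a b c; lra.
Qed.

End Gradient.

(** * The algorithm *)

Section SparseProblem.
Context {R : realType}.
Variables (T alpha beta : R).
Hypotheses (T_gt0 : 0 < T) (alpha_gt0 : 0 < alpha) (beta_gt0 : 0 < beta).
Implicit Types (A B : {fset (R -> R)}) (lam : (R -> R) -> R) (u v l g : R -> R).

Lemma BV_L2 u : BV T u -> L2 T u.
Proof.
move=> [/L1P[mu_ ui] [m um]]; have [M M0 uM] := BV_ess_bounded T_gt0 ui um.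
exact: ess_bounded_L2 uM.
Qed.

Lemma tgv_le_L2 u c : tgv_le T alpha beta u c -> L2 T u.
Proof. by move=> /(tgv_le_TGV T_gt0 alpha_gt0 beta_gt0)[/BV_L2]. Qed.

Lemma affine_L2 l : affine_fun l -> L2 T l.
Proof.
by move=> [c [d ->]]; exact: tgv_le_L2 (tgv_le_affine alpha beta T_gt0 c d).
Qed.

Lemma affine_fun_scale a l : affine_fun l -> affine_fun (a *: l).
Proof.
move=> [c [d ->]]; exists (a * c), (a * d); apply/funext => x.
by have -> : (a *: (fun x => c * x + d)) x = a * (c * x + d) by []; ring.
Qed.

Lemma affine_fun_add l l' : affine_fun l -> affine_fun l' -> affine_fun (l + l').
Proof.
move=> [c [d ->]] [c' [d' ->]]; exists (c + c'), (d + d'); apply/funext => x.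
have -> : ((fun x => c * x + d) + (fun x => c' * x + d')) x = (c * x + d) + (c' * x + d') by [].
by ring.
Qed.

Lemma combination_scale a A lam l :
  combination A (fun v => a * lam v) (a *: l) = a *: combination A lam l.
Proof.
rewrite /combination scalerDr scaler_sumr; congr (_ + _).
by apply: eq_bigr => v _; rewrite scalerA.
Qed.

Lemma tgv_le_combination A lam l : (forall v, v \in A -> 0 <= lam v) ->
  (forall v, v \in A -> tgv_le T alpha beta v 1) -> affine_fun l ->
  tgv_le T alpha beta (combination A lam l) (\sum_(v <- A) lam v).
Proof.
move=> lam0 atomA [c [d ->]]; rewrite /combination.
have := tgv_le_affine alpha beta T_gt0 c d; move: (fun x => _) => l' hl.
have : forall v, v \in (A : seq _) -> 0 <= lam v /\ tgv_le T alpha beta v 1.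
  by move=> v vA; split; [exact: lam0|exact: atomA].
elim: (A : seq _) => [|v s IH] H; first by rewrite !big_nil add0r.
rewrite !big_cons -addrA.
have [v0 vt] := H v (mem_head _ _).
have {}IH := IH (fun w ws => H w (mem_behead (s := v :: s) ws)).
have := tgv_le_lin T_gt0 (lam v) vt IH.
by rewrite ger0_norm// mulr1.
Qed.

Lemma sum_prune {V : nmodType} A lam (F : (R -> R) -> V) :
  (forall v, lam v = 0 -> F v = 0) ->
  \sum_(v <- prune A lam) F v = \sum_(v <- A) F v.
Proof.
move=> F0; apply: big_fset_incl.
  by apply/fsubsetP => v; rewrite !inE => /andP[].
by move=> v vA; rewrite !inE vA/= negbK => /eqP/F0.
Qed.

Lemma combination_prune A lam l :
  combination (prune A lam) lam l = combination A lam l.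
Proof.
by rewrite /combination sum_prune// => v ->; rewrite scale0r.
Qed.

Lemma minimizer_optimality (f : (R -> R) -> R) A lam l g :
  minimizerP f A lam l -> is_gradient T f (combination A lam l) g ->
  (forall v, v \in A -> tgv_le T alpha beta v 1) ->
  (forall l', affine_fun l' -> dotL2 T g l' = 0) /\
  dotL2 T g (combination A lam l) + \sum_(v <- A) lam v = 0.
Proof.
move=> [[lam0 afl] opt] ug atomA; set u := combination A lam l in ug *.
have uL : L2 T u := tgv_le_L2 (tgv_le_combination lam0 atomA afl).
have gL : L2 T g by case: ug.
have half l' : affine_fun l' -> 0 <= dotL2 T g l'.
  move=> afl'; rewrite -[dotL2 _ _ _]addr0.
  apply: (first_order ug uL (affine_L2 afl')) => t _; rewrite mulr0 addr0.
  have feas : feasible A lam (l + t *: l').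
    by split=> //; apply: affine_fun_add => //; exact: affine_fun_scale.
  have := opt _ _ feas; rewrite /objective lerD2r.
  by rewrite /u /combination addrA.
split.
  move=> l' afl'; apply/eqP; rewrite eq_le half// andbT.
  have := half _ (affine_fun_scale (-1) afl').
  by rewrite dotL2Zr// ?mulN1r ?oppr_ge0//; exact: affine_L2.
have scal s : `|s| <= 1 -> 0 <= s * (dotL2 T g u + \sum_(v <- A) lam v).
  rewrite ler_norml => /andP[s1 s2]; rewrite mulrDr -dotL2Zr//.
  apply: (first_order ug uL (L2_scale s uL)) => t /andP[t0 t1].
  have ts : 0 <= 1 + t * s by nra.
  have feas : feasible A (fun v => (1 + t * s) * lam v) ((1 + t * s) *: l).
    by split; [move=> v vA; rewrite mulr_ge0// lam0|exact: affine_fun_scale].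
  have := opt _ _ feas; rewrite /objective combination_scale -/u -mulr_sumr.
  rewrite (_ : (1 + t * s) *: u = u + t *: (s *: u)); last first.
    by rewrite scalerDl scale1r scalerA.
  move: (f u) (f (u + _)) (\sum_(_ <- _) _) => a b c; lra.
have h1 := scal 1; have h2 := scal (-1).
rewrite normr1 lexx mul1r in h1; rewrite normrN normr1 lexx mulN1r oppr_ge0 in h2.
by apply/eqP; rewrite eq_le h1// h2.
Qed.

End SparseProblem.

Lemma recursive_rate {R : realFieldType} (r : nat -> R) (d : R) : 0 < d ->
  (forall k, (1 <= k)%N -> 0 <= r k) ->
  (forall k s, (1 <= k)%N -> 0 <= s <= 1 ->
    r k.+1 <= (1 - s) * r k + s ^+ 2 * (d / 4)) ->
  forall k, (1 <= k)%N -> r k <= r 1%N / (1 + r 1%N / d * (k%:R - 1)).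
Proof.
move=> d0 r0 rec [//|k] _; rewrite -natr1 addrK.
have r10 : 0 <= r 1%N by exact: r0.
have den n : 1 + r 1%N / d * n%:R = (d + r 1%N * n%:R) / d.
  by field; rewrite gt_eqF.
have W0 n : 0 < d + r 1%N * n%:R by rewrite ltr_pwDl// mulr_ge0.
rewrite den invf_div mulrA.
elim: k => [|k IH]; first by rewrite mulr0 addr0 -mulrA divff ?gt_eqF// mulr1.
set W := d + r 1%N * k%:R in IH; have W_gt0 : 0 < W by exact: W0.
have -> : d + r 1%N * k.+1%:R = W + r 1%N by rewrite /W -natr1; ring.
have W1 : 0 < W + r 1%N by rewrite ltr_pwDl.
rewrite ler_pdivlMr//.
(* [s] minimizes the bound of [rec] with the inductive bound [r 1 * d / W] for [r k.+1]. *)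
have [small|big] := leP (2 * r 1%N) W.
- have s01 : 0 <= 2 * r 1%N / W <= 1.
    by rewrite divr_ge0 ?mulr_ge0 ?(ltW W_gt0)//= ler_pdivrMr// mul1r.
  have := rec k.+1 _ isT s01.
  move: (r k.+2) (r k.+1) IH => y' y IH h.
  have s0 : 0 <= 1 - 2 * r 1%N / W by rewrite subr_ge0; case/andP: s01.
  have {}h := le_trans h (lerD (ler_wpM2l s0 IH) (lexx _)).
  have E : (1 - 2 * r 1%N / W) * (r 1%N * d / W) + (2 * r 1%N / W) ^+ 2 * (d / 4) =
      r 1%N * d * ((W - r 1%N) / W ^+ 2) by field; rewrite gt_eqF.
  rewrite E in h.
  apply: (le_trans (ler_wpM2r (ltW W1) h)).
  rewrite -[leLHS]mulrA ler_piMr ?mulr_ge0 ?(ltW d0)// mulrAC ler_pdivrMr ?exprn_gt0// mul1r.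
  have : 0 <= r 1%N * r 1%N by rewrite mulr_ge0.
  move: (r 1%N) => a; nra.
- have := rec k.+1 1 isT; rewrite ler01 lexx subrr mul0r add0r expr1n mul1r => /(_ isT) h.
  apply: (le_trans (ler_wpM2r (ltW W1) h)); move: (r 1%N) big d0 => a; nra.
Qed.

Section Run.
Context {R : realType}.
Variables (T alpha beta : R).
Hypotheses (T_gt0 : 0 < T) (alpha_gt0 : 0 < alpha) (beta_gt0 : 0 < beta).
Variables (f : (R -> R) -> R) (gradf : (R -> R) -> R -> R).
Hypothesis f_convex : convexL2 T f.
Hypothesis gradfE : forall u, L2 T u -> is_gradient T f u (gradf u).
Variables (A : nat -> {fset (R -> R)}) (lam : nat -> (R -> R) -> R).
Variables (l : nat -> R -> R) (xS xK : nat -> R).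
Hypothesis run : nonterminating_run T alpha beta f gradf A lam l xS xK.

Local Notation mu := (@lebesgue_measure R).
Local Notation D := (`]0, T[%classic : set R).
Local Notation intg u := (mu.-integrable D (EFin \o u)).

Let u := iterate A lam l.
Let uhat := new_atom T alpha beta gradf A lam l xS xK.
Let r := residual T alpha beta f A lam l.
Let p := pk gradf A lam l.
Let P := Pk gradf A lam l.
Let weight k := \sum_(v <- A k) lam k v.
Let ratio k := Num.max (normC T (p k) / alpha) (normC T (P k) / beta).

Lemma tgv_le_Sfun_scale a x : 0 < x < T -> `|a| <= 1 ->
  tgv_le T alpha beta ((a / alpha) *: Sfun T x) 1.
Proof.
move=> xT a1; apply: tgv_le_trans (tgv_le_scale T_gt0 _ (tgv_le_Sfun alpha beta T_gt0 xT)).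
by rewrite normrM normfV (gtr0_norm alpha_gt0) divfK ?gt_eqF.
Qed.

Lemma tgv_le_Kfun_scale a x : 0 < x < T -> `|a| <= 1 ->
  tgv_le T alpha beta ((a / beta) *: Kfun T x) 1.
Proof.
move=> xT a1; apply: tgv_le_trans (tgv_le_scale T_gt0 _ (tgv_le_Kfun alpha beta T_gt0 xT)).
by rewrite normrM normfV (gtr0_norm beta_gt0) divfK ?gt_eqF.
Qed.

Lemma tgv_le_ExtB v : ExtB T alpha beta v -> tgv_le T alpha beta v 1.
Proof.
have n1 : `|1 : R| <= 1 by rewrite normr1.
have nN1 : `|-1 : R| <= 1 by rewrite normrN normr1.
have ab : 0 < beta / alpha by rewrite divr_gt0.
move=> [[x xT [->|->]]|[x /andP[xl xr] [->|->]]].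
- by rewrite -[alpha^-1]mul1r; exact: tgv_le_Sfun_scale.
- by rewrite -scaleNr -mulN1r; exact: tgv_le_Sfun_scale.
- rewrite -[beta^-1]mul1r; apply: tgv_le_Kfun_scale => //.
  by rewrite (lt_trans ab xl) (lt_trans xr)// gtrBl.
- rewrite -scaleNr -mulN1r; apply: tgv_le_Kfun_scale => //.
  by rewrite (lt_trans ab xl) (lt_trans xr)// gtrBl.
Qed.

Lemma tgv_le_new_atom k : (1 <= k)%N -> tgv_le T alpha beta (uhat k) 1.
Proof.
move=> k1; have [xST _] := run_xS run k1; have [xKT _] := run_xK run k1.
have sg1 x : `|Num.sg x : R| <= 1 by rewrite normr_sg; case: (x != 0).
rewrite /uhat /new_atom; case: ifP => _.
  exact: tgv_le_Sfun_scale.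
exact: tgv_le_Kfun_scale.
Qed.

Lemma prune_sub (B : {fset (R -> R)}) (la : (R -> R) -> R) v : v \in prune B la -> v \in B.
Proof. by rewrite /prune !inE => /andP[]. Qed.

Lemma tgv_le_active k v : v \in A k -> tgv_le T alpha beta v 1.
Proof.
elim: k v => [|[|k] IH] v; first by move=> /(run_init run); exact: tgv_le_ExtB.
  by rewrite (run_prune1 run) => /prune_sub/(run_init run); exact: tgv_le_ExtB.
rewrite (run_prune run (k := k.+1) isT) => /prune_sub.
rewrite /enlarged inE => /orP[/IH//|]; rewrite inE => /eqP ->.
exact: tgv_le_new_atom.
Qed.

Lemma run_parent k : (1 <= k)%N -> exists B,
  [/\ minimizerP f B (lam k) (l k), A k = prune B (lam k) &
      forall v, v \in B -> tgv_le T alpha beta v 1].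
Proof.
case: k => [//|[|k]] _.
  exists (A 0%N); split; [exact: run_min1 run|exact: run_prune1 run|].
  by move=> v /(run_init run); exact: tgv_le_ExtB.
exists (enlarged T alpha beta gradf A lam l xS xK k.+1); split.
- exact: (run_min run (k := k.+1) isT).
- exact: (run_prune run (k := k.+1) isT).
- move=> v; rewrite /enlarged inE => /orP[/tgv_le_active//|]; rewrite inE => /eqP ->.
  exact: tgv_le_new_atom.
Qed.

Lemma run_feasible k : (1 <= k)%N -> feasible (A k) (lam k) (l k).
Proof.
move=> /run_parent[B [[[l0 al] _] -> _]]; split=> // v /prune_sub; exact: l0.
Qed.

Lemma tgv_le_iterate k : (1 <= k)%N -> tgv_le T alpha beta (u k) (weight k).
Proof.
move=> /run_feasible[l0 al]; apply: tgv_le_combination => //.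
exact: tgv_le_active.
Qed.

Lemma iterate_L2 k : (1 <= k)%N -> L2 T (u k).
Proof. by move=> /tgv_le_iterate/(tgv_le_L2 T_gt0 alpha_gt0 beta_gt0). Qed.

Lemma iterate_optimality k : (1 <= k)%N ->
  (forall l', affine_fun l' -> dotL2 T (gradf (u k)) l' = 0) /\
  dotL2 T (gradf (u k)) (u k) = - weight k.
Proof.
move=> k1; have [B [opt AB atomB]] := run_parent k1.
have uE : u k = combination B (lam k) (l k).
  by rewrite /u /iterate AB combination_prune.
have wE : weight k = \sum_(v <- B) lam k v by rewrite /weight AB sum_prune.
have gu := gradfE (iterate_L2 k1); rewrite uE in gu *.
have [orth /eqP] := minimizer_optimality T_gt0 alpha_gt0 beta_gt0 opt gu atomB.
by rewrite -wE addr_eq0 => /eqP E; split.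
Qed.

Section Step.
Variable k : nat.
Hypothesis k1 : (1 <= k)%N.
Let g := gradf (u k).

Lemma step_gradient_L2 : L2 T g.
Proof. by have [] := gradfE (iterate_L2 k1). Qed.

Lemma step_gradient_cst : \int[mu]_(x in D) g x = 0.
Proof.
have [h _] := iterate_optimality k1.
have /h : affine_fun (fun=> 1 : R) by exists 0, 1; apply/funext => x; rewrite mul0r add0r.
by rewrite dotL2E => h0; rewrite -[RHS]h0; apply: eq_Rintegral => x _; rewrite mulr1.
Qed.

Lemma step_gradient_id : \int[mu]_(x in D) (x * g x) = 0.
Proof.
have [h _] := iterate_optimality k1.
have /h : affine_fun (id : R -> R) by exists 1, 0; apply/funext => x; rewrite mul1r addr0.
by rewrite dotL2E => h0; rewrite -[RHS]h0; apply: eq_Rintegral => x _; rewrite mulrC.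
Qed.

Lemma ratio_gt1 : 1 < ratio k.
Proof.
rewrite ltNge; apply/negP => h; apply: (run_continues run k1).
move: h; rewrite /ratio ge_max => /andP[h1 h2]; split.
  by rewrite ler_pdivrMr// mul1r in h1.
by rewrite ler_pdivrMr// mul1r in h2.
Qed.

Lemma step_pairing_le v : BV T v -> `|dotL2 T g v| <= ratio k * TGV T alpha beta v.
Proof.
move=> vB; rewrite dotL2C dotL2E.
apply: (pairing_le_TGV T_gt0) => //.
- exact: L2_intg step_gradient_L2.
- exact: step_gradient_cst.
- exact: step_gradient_id.
- exact: lt_trans ltr01 ratio_gt1.
- by rewrite mulrC -ler_pdivrMr// le_max lexx.
- by rewrite mulrC -ler_pdivrMr// le_max lexx orbT.
Qed.

Lemma step_new_atom : dotL2 T g (uhat k) = - ratio k.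
Proof.
have [xST xSE] := run_xS run k1; have [xKT xKE] := run_xK run k1.
have gL := step_gradient_L2; have gi := L2_intg gL.
have SL := tgv_le_L2 T_gt0 alpha_gt0 beta_gt0 (tgv_le_Sfun alpha beta T_gt0 xST).
have KL := tgv_le_L2 T_gt0 alpha_gt0 beta_gt0 (tgv_le_Kfun alpha beta T_gt0 xKT).
have dS : dotL2 T g (Sfun T (xS k)) = - p k (xS k).
  by rewrite dotL2C dotL2E (pairing_Sfun T_gt0 gi step_gradient_cst step_gradient_id).
have dK : dotL2 T g (Kfun T (xK k)) = - P k (xK k).
  by rewrite dotL2C dotL2E (pairing_Kfun T_gt0 gi step_gradient_cst step_gradient_id).
rewrite /uhat /new_atom -/p -/P /ratio; case: ifP => [h|/negbT].
  by rewrite dotL2Zr// dS max_l// -xSE normrEsg -/p; ring.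
rewrite -ltNge => h; rewrite dotL2Zr// dK max_r ?(ltW h)// -xKE normrEsg -/P; ring.
Qed.

End Step.

Section Bounds.
Variable Cf : R.
Hypothesis f_ge : forall v, L2 T v -> - Cf <= f v.

Let M0 := f 0 + Cf.

Lemma M0_ge0 : 0 <= M0.
Proof. by have := f_ge (L2_0 T); rewrite /M0 -lerBlDr sub0r. Qed.

Lemma minJ_le v : BV T v -> minJ T f alpha beta <= J T f alpha beta v.
Proof.
move=> vB; apply: ge_inf; last by exists v.
exists (- Cf) => _ [w wB <-]; rewrite -[leLHS]addr0 lerD//.
  exact/f_ge/(BV_L2 T_gt0).
exact: (TGV_ge0 T_gt0 alpha_gt0 beta_gt0).
Qed.

Lemma J_iterate_le k : (1 <= k)%N ->
  J T f alpha beta (u k) - minJ T f alpha beta <= r k.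
Proof.
move=> k1; have [_ tu] := tgv_le_TGV T_gt0 alpha_gt0 beta_gt0 (tgv_le_iterate k1).
by rewrite /r /residual lerB// /J lerD2l.
Qed.

Lemma residual_ge0 k : (1 <= k)%N -> 0 <= r k.
Proof.
move=> k1; apply: le_trans (J_iterate_le k1); rewrite subr_ge0; apply: minJ_le.
by have [] := tgv_le_TGV T_gt0 alpha_gt0 beta_gt0 (tgv_le_iterate k1).
Qed.

Lemma step_lower_bound k v : (1 <= k)%N -> BV T v ->
  f (u k) + weight k <= f v + ratio k * TGV T alpha beta v.
Proof.
move=> k1 vB; have uL := iterate_L2 k1; have vL := BV_L2 T_gt0 vB.
have := convex_gradient f_convex (gradfE uL) uL vL.
rewrite dotL2Br//; last exact: step_gradient_L2.
have [_ ->] := iterate_optimality k1.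
have := step_pairing_le k1 vB; rewrite ler_norml => /andP[+ _].
move: (dotL2 _ _ _) (ratio k * _) => a b; lra.
Qed.

Lemma residual_le_violation k : (1 <= k)%N ->
  r k <= M0 * (ratio k - 1).
Proof.
move=> k1; rewrite /r /residual -/(weight k) -/(u k) lerBlDr -lerBlDl.
have rat1 : 0 <= ratio k - 1 by rewrite subr_ge0 ltW// ratio_gt1.
have psi0 : 0 <= M0 * (ratio k - 1) by rewrite mulr_ge0// M0_ge0.
have zB : BV T 0 by exact: BV_0.
apply: lb_le_inf; first by exists (J T f alpha beta 0); exists 0.
move=> _ [v vB <-]; rewrite lerBlDr.
have [Jv|Jv] := leP (J T f alpha beta v) (f 0).
  apply: (le_trans (step_lower_bound k1 vB)).
  have tM : TGV T alpha beta v <= M0.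
    have := f_ge (BV_L2 T_gt0 vB); move: Jv; rewrite /J /M0.
    move: (TGV _ _ _ _) (f v) (f 0) => a b c; lra.
  rewrite /J -addrA lerD2l; have := ler_wpM2r rat1 tM.
  move: (TGV _ _ _ _) (ratio k) (M0 * _) => a b c; lra.
have := step_lower_bound k1 zB.
have [_ t0] := tgv_le_TGV T_gt0 alpha_gt0 beta_gt0 (tgv_le_0 alpha beta T_gt0).
have rt0 : ratio k * TGV T alpha beta 0 <= 0.
  by rewrite pmulr_rle0// (lt_trans ltr01 (ratio_gt1 k1)).
move: psi0 Jv rt0; move: (M0 * _) (J _ _ _ _ _) (ratio k * _) (f (u k) + _) => a b c d; lra.
Qed.

Lemma step_candidate k s : (1 <= k)%N -> 0 <= s <= 1 ->
  f (u k.+1) + weight k.+1 <=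
  f (u k + s *: (M0 *: uhat k - u k)) + ((1 - s) * weight k + s * M0).
Proof.
move=> k1 /andP[s0 s1]; pose B := enlarged T alpha beta gradf A lam l xS xK k.
have [_ opt] := run_min run k1; rewrite -/B in opt.
have [l0 al] := run_feasible k1.
have AB : (A k `<=` B)%fset by exact: fsubsetUl.
have hB : uhat k \in B by rewrite /B /enlarged !inE eqxx orbT.
pose la v := (if v \in A k then (1 - s) * lam k v else 0) +
  (if v == uhat k then s * M0 else 0).
have feas : feasible B la ((1 - s) *: l k).
  split; last exact: affine_fun_scale.
  move=> v vB; rewrite /la addr_ge0//.
    by case: ifP => // vA; rewrite mulr_ge0 ?subr_ge0// l0.
  by case: ifP => // _; rewrite mulr_ge0// M0_ge0.
have := opt _ _ feas; rewrite {1}/objective.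
have -> : \sum_(v <- B) lam k.+1 v = weight k.+1.
  by rewrite /weight (run_prune run k1) sum_prune.
have -> : combination B (lam k.+1) (l k.+1) = u k.+1.
  by rewrite /u /iterate (run_prune run k1) combination_prune.
move/le_trans; apply; rewrite /objective.
have sumA (V : nmodType) (F : (R -> R) -> V) :
    \sum_(v <- B) (if v \in A k then F v else 0) = \sum_(v <- A k) F v.
  rewrite -(big_fset_incl _ AB); last by move=> v _ /negbTE ->.
  by rewrite big_seq [RHS]big_seq; apply: eq_bigr => v ->.
have sumH (V : nmodType) (F : (R -> R) -> V) :
    \sum_(v <- B) (if v == uhat k then F v else 0) = F (uhat k).
  rewrite (big_fsetD1 _ hB)/= eqxx big_seq big1 ?addr0// => v.
  by rewrite !inE => /andP[/negbTE ->].
have -> : \sum_(v <- B) la v = (1 - s) * weight k + s * M0.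
  rewrite big_split/= (sumA _ (fun v => (1 - s) * lam k v)) (sumH _ (fun=> s * M0)).
  by rewrite -mulr_sumr.
rewrite lerD2r le_eqVlt; apply/orP; left; apply/eqP; congr f.
rewrite /combination.
have -> : \sum_(v <- B) la v *: v = (1 - s) *: (\sum_(v <- A k) lam k v *: v) + (s * M0) *: uhat k.
  rewrite scaler_sumr -(sumH _ (fun v => (s * M0) *: v)).
  rewrite -(sumA _ (fun v => (1 - s) *: (lam k v *: v))) -big_split/=.
  apply: eq_bigr => v _; rewrite /la scalerDl.
  by congr (_ + _); case: ifP; rewrite ?scale0r ?scalerA.
rewrite addrAC -scalerDr -/(combination (A k) (lam k) (l k)) -/(iterate A lam l k) -/(u k).
by rewrite scalerBl scale1r scalerBr scalerA addrAC -addrA.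
Qed.

Lemma residual_step (L C : R) k s : 0 < L ->
  (forall u1 u2, L2 T u1 -> L2 T u2 ->
     normL2 T (gradf u1 - gradf u2) <= L * normL2 T (u1 - u2)) ->
  (1 <= k)%N -> normL2 T (u k) <= C -> M0 * normL2 T (uhat k) <= C -> 0 <= s <= 1 ->
  r k.+1 <= (1 - s) * r k + s ^+ 2 * (8 * L * C ^+ 2 / 4).
Proof.
move=> L0 lip k1 uC hC s01; have /andP[s0 s1] := s01.
have uL := iterate_L2 k1.
have hL : L2 T (uhat k) := tgv_le_L2 T_gt0 alpha_gt0 beta_gt0 (tgv_le_new_atom k1).
have MhL := L2_scale M0 hL; have dL := L2_sub MhL uL.
have gL := step_gradient_L2 k1.
have := descent f_convex gradfE (ltW L0) lip uL (L2_scale s dL).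
rewrite dotL2Zr// dotL2Br// dotL2Zr// step_new_atom//.
have [_ ->] := iterate_optimality k1.
have dC : normL2 T (M0 *: uhat k - u k) <= 2 * C.
  rewrite (le_trans (normL2D MhL (L2_opp uL)))// mulr2n mulrDl mul1r lerD//.
    by rewrite normL2Z// ger0_norm// M0_ge0.
  by rewrite -scaleN1r normL2Z// normrN normr1 mul1r.
rewrite (normL2Z s dL) (ger0_norm s0).
have sq : (s * normL2 T (M0 *: uhat k - u k)) ^+ 2 <= s ^+ 2 * (4 * C ^+ 2).
  rewrite exprMn ler_wpM2l ?sqr_ge0//.
  have -> : 4 * C ^+ 2 = (2 * C) ^+ 2 by ring.
  by rewrite ler_pXn2r// ?nnegrE ?normL2_ge0// (le_trans (normL2_ge0 _ _) dC).
have L20 : 0 <= L / 2 by rewrite divr_ge0// ltW.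
have {}sq := ler_wpM2l L20 sq.
have := step_candidate k1 s01; have := residual_le_violation k1.
move=> /(ler_wpM2l s0); rewrite {1 2 3}/r /residual -!/(weight _) -!/(u _).
move: sq; set q := (s * normL2 _ _) ^+ 2; move: q (minJ _ _ _ _) => q mJ.
move: (f (u k + _)) (f (u k.+1)) (f (u k)) (weight k) (weight k.+1) (ratio k) => a b c w w' rho.
lra.
Qed.

End Bounds.
End Run.

Theorem theorem9 (R : realType) (T alpha beta : R)
  (T_gt0 : 0 < T) (alpha_gt0 : 0 < alpha) (beta_gt0 : 0 < beta)
  (f : (R -> R) -> R) (gradf : (R -> R) -> R -> R)
  (f_ae : ae_invariant T f)
  (f_convex : convexL2 T f)
  (A1 : continuously_frechet_differentiable T f)
  (gradfE : forall u, L2 T u -> is_gradient T f u (gradf u))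
  (Lf : R) (Lf_gt0 : 0 < Lf)
  (A2 : forall u1 u2, L2 T u1 -> L2 T u2 ->
          normL2 T (gradf u1 - gradf u2) <= Lf * normL2 T (u1 - u2))
  (Cf : R) (Cf_gt0 : 0 < Cf)
  (A3 : forall u, L2 T u -> f u >= - Cf)
  (A4 : bounded_sublevels T f alpha beta)
  (A : nat -> {fset (R -> R)}) (lam : nat -> (R -> R) -> R)
  (l : nat -> R -> R) (xS xK : nat -> R)
  (run : nonterminating_run T alpha beta f gradf A lam l xS xK) :
  let u := iterate A lam l in
  let uhat := new_atom T alpha beta gradf A lam l xS xK in
  let r := residual T alpha beta f A lam l in
  let Psi := violation T alpha beta f gradf A lam l Cf in
  let M0 := f 0 + Cf in
  (forall k, (1 <= k)%N ->
     J T f alpha beta (u k) - minJ T f alpha beta <= r k /\ r k <= Psi k) /\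
  (forall C : R, 0 < C ->
     (forall k, (1 <= k)%N ->
        Num.max (normL2 T (u k)) (M0 * normL2 T (uhat k)) <= C) ->
     let q := r 1%N / (8 * Lf * C ^+ 2) in
     forall k, (1 <= k)%N ->
       J T f alpha beta (u k) - minJ T f alpha beta <= r k /\
       r k <= r 1%N / (1 + q * (k%:R - 1))).

Proof.
move=> u uhat r Psi M0; split.
  move=> k k1; split; first exact: (J_iterate_le T_gt0 alpha_gt0 beta_gt0 run).
  exact: (residual_le_violation T_gt0 alpha_gt0 beta_gt0 f_convex gradfE run A3 k1).
move=> C C0 hC q k k1; split; first exact: (J_iterate_le T_gt0 alpha_gt0 beta_gt0 run).
apply: recursive_rate => //.
- by rewrite mulr_gt0 ?exprn_gt0// mulr_gt0.
- by move=> n n1; exact: (residual_ge0 T_gt0 alpha_gt0 beta_gt0 run A3 n1).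
- move=> n s n1 s01; have := hC n n1; rewrite ge_max => /andP[h1 h2].
  exact: (residual_step T_gt0 alpha_gt0 beta_gt0 f_convex gradfE run A3 Lf_gt0 A2 n1 h1 h2 s01).
Qed.
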